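(* Let $\pi=(\pi_\omega)_{\omega}$ be a prior for a bridged model with parameter functor $\Theta_{\mathsf{Meas}}:\mathsf\Omega^{\mathrm{op}}\to\mathsf{Meas}$. (1) If $\pi$ is coherent at $\psi:\omega\to\omega'$, then $\pi_\omega$ vanishes on the measurable subsets of $\Theta_{\mathsf{Meas}}(\omega)$ which are disjoint from the image of $\Theta_{\mathsf{Meas}}(\psi)$. (2) If $\pi$ is coherent over $\mathsf\Omega_{\mathrm{inj}}$, then $\pi_\omega$ is invariant under $\Theta_{\mathsf{Meas}}(\mathrm{Aut}\,\omega)$ for every $\omega$, i.e. $\Theta_{\mathsf{Meas}}(\alpha)_*\pi_\omega=\pi_\omega$ for every automorphism $\alpha$ of $\omega$ in $\mathsf\Omega$. Coherence over $\mathsf\Omega_{\mathrm{red}}$ imposes no such symmetry (it does not in general imply this invariance). (3) Let $\mathbf P$ be the Gaussian linear model with known variance $\sigma_0^2>0$, let $\tau^2>0$, and let $\pi^\tau_\omega=\mathcal N(0,\tau^2I_\omega)\otimes\delta_{\sigma_0^2}$ be the prior associated to a choice of inner products on the covariate spaces which restrict along the insertions, where $I_\omega$ is the induced form on $\omega^*$. Then, for every design $d=(u,\omega,x)$, the Bayesian inversion of $\mathbf P_d$ with respect to $\pi^\tau_\omega$ exists in $\mathsf{BorelStoch}$, and it is (up to the factor $\delta_{\sigma_0^2}$) the Gaussian kernel whose mean is the ridge estimator $y\mapsto(X^{\top}X+\lambda I)^{-1}X^{\top}y$ with penalty $\lambda=\sigma_0^2/\tau^2$, where $X$ is the matrix of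 $x$ in an orthonormal basis of $\omega$. The prior $\pi^\tau$ is coherent over $\mathsf\Omega_{\mathrm{red}}$, and it is coherent at a linear automorphism $A$ of a covariate space if and only if $A$ is orthogonal for the chosen inner product. In particular, it is not coherent over $\mathsf\Omega_{\mathrm{inj}}$.
   Context: Ambient category: $\mathsf{BorelStoch}$, whose objects are the standard Borel spaces and whose morphisms $X\rightsquigarrow Y$ are the Markov kernels, composed by $(k'\circ k)(x)(C)=\int k'(y)(C)\,k(x)(\mathrm dy)$; all parameter objects and sample spaces are assumed standard Borel. $I$ is the one-point space; a state $I\rightsquigarrow X$ is a probability measure on $X$. $\mathsf\Omega$ is a category of covariate spaces (sets with structure) and $\Theta_{\mathsf{Meas}}:\mathsf\Omega^{\mathrm{op}}\to\mathsf{Meas}$ is the (measurable) parameter functor of the bridged model; the bridged model itself is a natural family of Markov kernels $\mathbf P_{v,d}:\Theta_{\mathsf{Meas}}(\omega)\rightsquigarrow\Gamma(v,u)$ indexed by response scales $v$ and designs $d=(u,\omega,x)$, from parameter objects to sample spaces. The notions below in parts (1),(2) depend on the model only through $\Theta_{\mathsf{Meas}}$. A prior is a family of probability measures $\pi_\omega$ on $\Theta_{\mathsf{Meas}}(\omega)$, $\omega\in\mathrm{ob}\,\mathsf\Omega$. It is coherent at $\psi:\omega\to\omega'$ if $\pi_\omega=\Theta_{\mathsf{Meas}}(\psi)_*\pi_{\omega'}$, and coherent over a subcategory $\mathsf Q\subseteq\mathsf\Omega$ (containing all objects) if it is coherent at every morphism of $\mathsf Q$. An insertion is a proper inclusion $\omega'\subsetneq\omega$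 between objects of $\mathsf\Omega$. $\mathsf\Omega_{\mathrm{red}}$ is the subcategory generated by the insertions (its morphisms are the inclusions), and $\mathsf\Omega_{\mathrm{inj}}$ the subcategory generated by $\mathsf\Omega_{\mathrm{red}}$ and the isomorphisms of $\mathsf\Omega$. Bayesian inversion: for a state $\pi$ on $X$ and a kernel $k:X\rightsquigarrow Y$, with $m=k\circ\pi$, a Bayesian inversion of $k$ with respect to $\pi$ is a kernel $k^\dagger:Y\rightsquigarrow X$ with $\int_{S}k(x)(T)\,\pi(\mathrm dx)=\int_T k^\dagger(y)(S)\,m(\mathrm dy)$ for all measurable $S\subseteq X$, $T\subseteq Y$ (unique up to $m$-a.s. equality). Gaussian linear model (part 3): $\mathsf\Omega$ is the category whose objects are the linear subspaces of the coordinate spaces $\mathbb R^p$, $p\ge0$, with all linear maps; units are finite sets $u$ with injective maps; a design $(u,\omega,x)$ is a map $x:u\to\omega$; $\Theta(\omega)=\omega^*\times\mathbb R_{>0}$ (Borel structure), $\Theta(\psi)(\beta',\sigma^2)=(\beta'\circ\psi,\sigma^2)$; the sample space is $\mathbb R^u$; $\mathbf P_d(\beta,\sigma^2)=\bigotimes_{i\in u}\mathcal N(\beta(x(i)),\sigma^2)$. A choice of inner products $\langle\,,\rangle_\omega$ on all $\omega$ restricts along the insertions if $\langle\,,\rangle_{\omega'}=\langle\,,\rangle_\omega|_{\omega'}$ whenever $\omega'\subseteq\omega$. In an orthonormal basis of $\omega$ ($p=\dim\omega$) and the dual coordinates of $\omega^*$, $\mathcal N(0,\tau^2I_\omega)$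 is the centred Gaussian with covariance $\tau^2I_p$, and after enumerating $u$ ($n=|u|$), $X$ is the $n\times p$ matrix whose $i$-th row is the coordinate vector of $x(i)$. *)

(* Defs.v *)
From HB Require Import structures.
From mathcomp Require Import all_boot all_order all_algebra.
From mathcomp Require Import sesquilinear.
From mathcomp Require Import all_classical all_reals all_analysis.
From mathcomp Require Import giry measurable_realfun.

Set Implicit Arguments.
Unset Strict Implicit.
Unset Printing Implicit Defensive.
Import Order.TTheory GRing.Theory Num.Theory.
Import numFieldNormedType.Exports.

Local Open Scope classical_set_scope.
Local Open Scope ring_scope.

Section standard_borel.
Context (R : realType).

(* The Borel space of a Polish topology: second countable and metrizable by a
   complete metric (a pseudometric whose topology is Hausdorff). *)
Definition standard_borel d (T : measurableType d) : Prop :=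
  exists (X : completePseudoMetricType R) (f : T -> X),
    [/\ hausdorff_space X, @second_countable X, bijective f
      & forall A : set T, measurable A <-> <<s (@open X) >> (f @` A)].

Record borel_space := BorelSpace {
  bs_display : measure_display ;
  bs_space :> measurableType bs_display ;
  bs_standard : standard_borel bs_space }.

End standard_borel.

Section covariates.

(* A category of sets with structure: the forgetful functor [cov_fun] is
   faithful, which gives the category laws, and the underlying sets are embedded
   in a common universe, so that inclusions between objects make sense. *)
Record covariate_category := CovariateCategory {
  cov :> Type ;
  cov_el : cov -> Type ;
  cov_universe : Type ;
  cov_emb : forall w, cov_el w -> cov_universe ;
  cov_emb_inj : forall w, injective (@cov_emb w) ;
  cov_hom : cov -> cov -> Type ;
  cov_fun : forall w w', cov_hom w w' -> cov_el w -> cov_el w' ;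
  cov_fun_inj : forall w w', injective (@cov_fun w w') ;
  cov_id : forall w, cov_hom w w ;
  cov_idE : forall w x, cov_fun (cov_id w) x = x ;
  cov_comp : forall a b c, cov_hom b c -> cov_hom a b -> cov_hom a c ;
  cov_compE : forall a b c (g : cov_hom b c) (f : cov_hom a b) x,
    cov_fun (cov_comp g f) x = cov_fun g (cov_fun f x) }.

Variable Om : covariate_category.
Implicit Types a b c : Om.

Definition hom_class := forall a b, cov_hom a b -> Prop.

(* A morphism which is the inclusion of a proper subset. *)
Definition insertion : hom_class := fun a b f =>
  (forall x, cov_emb (cov_fun f x) = cov_emb x) /\
  exists y : cov_el b, forall x : cov_el a, cov_emb x <> cov_emb y.

Definition iso : hom_class := fun a b f =>
  exists g : cov_hom b a, cov_comp g f = cov_id a /\ cov_comp f g = cov_id b.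

(* The subcategory, containing all the objects, generated by a class of
   morphisms. *)
Inductive generated (S : hom_class) : hom_class :=
| gen_base a b (f : cov_hom a b) : S a b f -> generated S f
| gen_id a : generated S (cov_id a)
| gen_comp a b c (g : cov_hom b c) (f : cov_hom a b) :
    generated S g -> generated S f -> generated S (cov_comp g f).

Definition Omega_red : hom_class := generated insertion.

Definition Omega_inj : hom_class :=
  generated (fun a b f => Omega_red f \/ iso f).

End covariates.

Section priors.
Context (R : realType) (Om : covariate_category).

Record parameter_functor := ParameterFunctor {
  par :> Om -> borel_space R ;
  par_map : forall a b, cov_hom a b -> {mfun par b >-> par a} ;
  par_id : forall a t, par_map (cov_id a) t = t ;
  par_comp : forall a b c (g : @cov_hom Om b c) (f : cov_hom a b) t,
    par_map (cov_comp g f) t = par_map f (par_map g t) }.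

Variable Theta : parameter_functor.

Definition prior := forall a : Om, probability (Theta a) R.

Implicit Types pi : prior.

Definition coherent_at pi a b (f : @cov_hom Om a b) :=
  pi a ≡μ distribution (pi b) (par_map Theta f).

Definition coherent_over pi (Q : hom_class Om) :=
  forall a b (f : cov_hom a b), Q a b f -> coherent_at pi f.

Definition Aut_invariant pi :=
  forall a (f : @cov_hom Om a a), iso f ->
    distribution (pi a) (par_map Theta f) ≡μ pi a.

End priors.

Section bayes.
Context (R : realType) d d' (X : measurableType d) (Y : measurableType d').

Lemma measurable_cst_state (pi : probability X R) :
  measurable_fun [set: unit] (fun=> pi : pprobability X R).
Proof. exact: measurable_cst. Qed.

(* The composite of the state pi with the kernel k. *)
Definition marginal (pi : probability X R) (k : R.-pker X ~> Y)
    : {measure set Y -> \bar R} :=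
  mkcomp_noparam (kprobability (measurable_cst_state pi)) k tt.

Definition bayesian_inversion (pi : probability X R) (k : R.-pker X ~> Y)
    (k' : R.-pker Y ~> X) :=
  forall (S : set X) (T : set Y), measurable S -> measurable T ->
    (\int[pi]_(x in S) k x T = \int[marginal pi k]_(y in T) k' y S)%E.

End bayes.

Section evaluation.
Context (R : realType).

Definition eval_system (T I : Type) (ev : T -> I -> R) : set (set T) :=
  [set A | exists (i : I) (B : set R), measurable B /\ A = ev^~ i @^-1` B].

Lemma measurable_eval (T : pointedType) (I : Type) (ev : T -> I -> R) i :
  measurable_fun [set: g_sigma_algebraType (eval_system ev)] (ev^~ i).
Proof.
move=> _ B mB; rewrite setTI; apply: sub_sigma_algebra; by exists i, B.
Qed.

Lemma measurable_evalP d (X : measurableType d) (T : pointedType) (I : Type)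
    (ev : T -> I -> R) (f : X -> g_sigma_algebraType (eval_system ev)) :
  (forall i, measurable_fun [set: X] (fun x => ev (f x) i)) ->
  measurable_fun [set: X] f.
Proof.
move=> mf; apply: (@measurability _ _ _ (g_sigma_algebraType (eval_system ev))
  setT f (eval_system ev)) => //.
move=> _ [_ [i [B [mB ->]]] <-].
exact: mf.
Qed.

End evaluation.

Section borel_rV.
Context (R : realType) (n : nat).

Let borel := g_sigma_algebraType (@open 'rV[R]_n).

Lemma continuous_coord (i : 'I_n) : continuous (fun v : 'rV[R]_n => v 0 i).
Proof. exact: coord_continuous. Qed.

Lemma measurable_coord (i : 'I_n) :
  measurable_fun [set: borel] (fun v : 'rV[R]_n => v 0 i).
Proof.
apply: (measurability _ (RGenOpens.measurableE R)).
move=> _ [_ [x [y ->]] <-]; rewrite setTI; apply: sub_sigma_algebra.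
have oB : open `]x, y[%classic by exact: interval_open.
by move/continuousP : (@continuous_coord i); apply.
Qed.

Definition rat_box (c : rat ^ n * nat) : set 'rV[R]_n :=
  ball (\row_i (ratr (c.1 i) : R)) (c.2.+1%:R^-1).

Lemma rat_boxE c : rat_box c =
  \bigcap_(i in [set: 'I_n])
    [set v | ball (ratr (c.1 i) : R) (c.2.+1%:R^-1) (v 0 i)].
Proof.
apply/seteqP; split=> [v [_ bv] i _ /=|v bv].
  by have := bv 0 i; rewrite mxE.
split; first by rewrite invr_gt0.
by move=> j i; rewrite mxE ord1; apply: bv.
Qed.

Lemma rat_box_basis : basis (range rat_box).
Proof.
split.
  move=> _ [c _ <-]; exact/ball_open.
move=> x A; rewrite -nbhs_ballE => -[e /= e0 xeA].
pose m := Num.truncn (2 / e).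
have m2 : m.+1%:R^-1 < e / 2 :> R.
  rewrite -[e / 2]invf_div ltf_pV2 ?posrE ?divr_gt0//.
  exact: Num.Theory.truncnS_gt.
have q (i : 'I_n) : {q : rat | ball (ratr q : R) (m.+1%:R^-1) (x 0 i)}.
  have lt : x 0 i - m.+1%:R^-1 < x 0 i + m.+1%:R^-1 :> R.
    have m0 : 0 < m.+1%:R^-1 :> R by rewrite invr_gt0.
    by rewrite (lt_trans (y := x 0 i)) ?ltrDl// ltrBlDr ltrDl.
  apply: cid; have [q] := rat_in_itvoo lt.
  rewrite in_itv/= => /andP[lo hi]; exists q.
  by rewrite /ball/= ltr_distl lo hi.
pose c := ([ffun i => sval (q i)], m).
exists (rat_box c) => /=.
  split; first by exists c.
  rewrite rat_boxE => i _ /=; rewrite ffunE; exact: (svalP (q i)).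
apply: subset_trans xeA => y.
rewrite rat_boxE => By; split => // j i; rewrite ord1.
have := By i I; have := svalP (q i); rewrite /= ffunE => h1 h2.
apply: (@le_ball _ _ _ (m.+1%:R^-1 + m.+1%:R^-1)).
  by rewrite [leRHS]splitr lerD// ltW.
exact/(ball_triangle _ h2)/ball_sym.
Qed.

Lemma rV_second_countable : @second_countable 'rV[R]_n.
Proof.
exists (range rat_box); last exact: rat_box_basis.
by apply: (sub_countable (card_image_le _ _)); exact: countableP.
Qed.

Lemma rV_open_box (U : set 'rV[R]_n) : open U ->
  U = \bigcup_(c in [set c | rat_box c `<=` U]) rat_box c.
Proof.
move=> oU; apply/seteqP; split=> [x Ux|x [c cU cx]]; last exact: cU.
have [_ /(_ x U)] := rat_box_basis.
case; first exact: open_nbhs_nbhs.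
by move=> _ [[c _ <-] cx] cU; exists c.
Qed.

Lemma measurable_rV d (X : measurableType d) (f : X -> borel) :
  (forall i, measurable_fun [set: X] (fun x => (f x : 'rV[R]_n) 0 i)) ->
  measurable_fun [set: X] f.
Proof.
move=> mf; apply: (@measurability _ _ _ borel setT f (@open 'rV[R]_n)) => //.
move=> _ [U oU <-]; rewrite setTI (rV_open_box oU) preimage_bigcup.
rewrite bigcup_mkcond; apply: countable_bigcupT_measurable.
  exact: countableP.
move=> c; case: ifPn => // _; rewrite rat_boxE preimage_bigcap.
apply: fin_bigcap_measurable => //.
move=> i _; rewrite -[X in measurable X]setTI.
have /(mf i measurableT) // :
  measurable (ball (ratr (c.1 i) : R) (c.2.+1%:R^-1)).
by apply: open_measurable; exact: ball_open.
Qed.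

Lemma standard_borel_rV d (X : measurableType d) (F : X -> 'rV[R]_n)
    (G : 'rV[R]_n -> X) : cancel F G -> cancel G F ->
  (forall i, measurable_fun [set: X] (fun x => F x 0 i)) ->
  measurable_fun [set: borel] G -> standard_borel R X.
Proof.
move=> FG GF mF mG; exists 'rV[R]_n, F; split.
- exact: norm_hausdorff.
- exact: rV_second_countable.
- by exists G.
- move=> A; have FA : F @` A = G @^-1` A.
    apply/seteqP; split=> [_ [x Ax <-]|v Av] /=; first by rewrite FG.
    by exists (G v).
  split=> [mA|mFA].
    by rewrite FA -[X in <<s _ >> X]setTI; exact: mG.
  rewrite -[A](_ : F @^-1` (F @` A) = A); last first.
    by apply/seteqP; split=> [x [y Ay /(can_inj FG) <-//]|x Ax]; exists x.
  by rewrite -[X in measurable X]setTI; exact: (measurable_rV mF).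
Qed.

End borel_rV.

Section real_function_spaces.
Context (R : realType).

HB.instance Definition _ (u : finType) :=
  isPointed.Build {ffun u -> R} [ffun=> 0].
HB.instance Definition _ :=
  isPointed.Build {s : R | 0 < s} (exist _ 1 (@ltr01 R)).
HB.instance Definition _ (V : vectType R) :=
  isPointed.Build 'Hom(V, R^o) 0%VF.

(* On the finite-dimensional spaces R^u and V^*, as on R_{>0}, the Borel
   sigma-algebra is generated by the evaluation functionals. *)
Definition Rpow (u : finType) : measurableType _ := g_sigma_algebraType
  (eval_system (fun (y : {ffun u -> R}) i => y i)).

Definition dual_space (V : vectType R) : measurableType _ := g_sigma_algebraType
  (eval_system (fun (b : 'Hom(V, R^o)) v => b v : R)).

Definition Rpos : measurableType _ := g_sigma_algebraType
  (eval_system (fun (s : {s : R | 0 < s}) (_ : unit) => val s)).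

Lemma measurable_sample (u : finType) i :
  measurable_fun [set: Rpow u] (fun y => (y : {ffun u -> R}) i).
Proof. exact: (@measurable_eval R {ffun u -> R}). Qed.

Lemma measurable_dual V v :
  measurable_fun [set: dual_space V] (fun b => (b : 'Hom(V, R^o)) v : R).
Proof. exact: (@measurable_eval R 'Hom(V, R^o)). Qed.

Lemma measurable_Rpos :
  measurable_fun [set: Rpos] (fun s => val (s : {s : R | 0 < s})).
Proof. exact: (@measurable_eval R {s : R | 0 < s} _ _ tt). Qed.

Section sample_borel.
Variable u : finType.

Let F (y : Rpow u) : 'rV[R]_#|u| := \row_i (y : {ffun u -> R}) (enum_val i).
Let G (v : 'rV[R]_#|u|) : Rpow u := [ffun i => v 0 (enum_rank i)].

Lemma standard_borel_sample : standard_borel R (Rpow u).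
Proof.
apply: (@standard_borel_rV _ _ _ _ F G).
- by move=> y; apply/ffunP => i; rewrite ffunE mxE enum_rankK.
- by move=> v; apply/rowP => i; rewrite mxE ffunE enum_valK.
- move=> i; rewrite [X in measurable_fun _ X](_ : _ =
    fun y => (y : {ffun u -> R}) (enum_val i)).
    exact: measurable_sample.
  by apply/funext => y; rewrite mxE.
- apply: measurable_evalP => i; rewrite [X in measurable_fun _ X](_ : _ =
    fun v : 'rV[R]_#|u| => v 0 (enum_rank i)); first exact: measurable_coord.
  by apply/funext => v; rewrite ffunE.
Qed.

Definition sample_space : borel_space R :=
  @BorelSpace R _ _ standard_borel_sample.

End sample_borel.

Section parameter_borel.
Variable V : vectType R.

Let n := \dim {: V}.

Definition dual_of_coords (e : n.-tuple V) (z : 'I_n -> R) : 'Hom(V, R^o) :=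
  \sum_i z i *: linfun (coord e i : V -> R^o).

Lemma dual_of_coordsE e z v :
  dual_of_coords e z v = \sum_i z i * coord e i v :> R.
Proof.
rewrite sum_lfunE; apply: eq_bigr => i _.
by rewrite scale_lfunE lfunE.
Qed.

Lemma dual_of_coordsK (e : n.-tuple V) z (i : 'I_n) : basis_of {: V} e ->
  dual_of_coords e z e`_i = z i :> R.
Proof.
move=> eb; rewrite dual_of_coordsE (bigD1 i)//= coord_free ?(basis_free eb)//.
rewrite eqxx mulr1 big1 ?addr0// => j ji.
by rewrite coord_free ?(basis_free eb)// eq_sym (negbTE ji) mulr0.
Qed.

Lemma dual_coordsK (e : n.-tuple V) (beta : 'Hom(V, R^o)) :
  basis_of {: V} e -> dual_of_coords e (fun i => beta e`_i) = beta.
Proof.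
move=> eb; apply/lfunP => v; rewrite dual_of_coordsE.
rewrite {2}(coord_basis eb (memvf v)) linear_sum; apply: eq_bigr => i _.
by rewrite linearZ/= mulrC.
Qed.

Lemma measurable_dual_of_coords d (X : measurableType d) (e : n.-tuple V)
    (z : X -> 'I_n -> R) : (forall i, measurable_fun [set: X] (z^~ i)) ->
  measurable_fun [set: X] (fun x => dual_of_coords e (z x) : dual_space V).
Proof.
move=> mz; apply: measurable_evalP => v.
rewrite [X in measurable_fun _ X](_ : _ =
  fun x => \sum_i z x i * coord e i v).
  by apply: measurable_sum => i; apply: measurable_funM.
by apply/funext => x; rewrite dual_of_coordsE.
Qed.

Let F (t : dual_space V * Rpos) : 'rV[R]_n.+1 :=
  \row_(i < n.+1) if unlift ord0 i is Some j
    then ((t.1 : 'Hom(V, R^o)) (vbasis {: V})`_j : R)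
    else ln (val (t.2 : {s : R | 0 < s})).

Let G (v : 'rV[R]_n.+1) : dual_space V * Rpos :=
  (dual_of_coords (vbasis {: V}) (fun i => v 0 (lift ord0 i)),
   exist _ (expR (v 0 ord0)) (expR_gt0 (v 0 ord0))).

Lemma standard_borel_parameters : standard_borel R (dual_space V * Rpos)%type.
Proof.
apply: (@standard_borel_rV _ _ _ _ F G).
- move=> [beta s]; rewrite /F /G; congr pair.
    rewrite -[RHS](dual_coordsK _ (vbasisP {: V})); congr dual_of_coords.
    by apply/funext => i; rewrite mxE liftK.
  by apply/val_inj; rewrite /= mxE unlift_none lnK// posrE (valP s).
- move=> v; apply/rowP => i; rewrite mxE.
  case: unliftP => [j ->|->] /=; last by rewrite expRK.
  by rewrite dual_of_coordsK ?vbasisP.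
- move=> i; rewrite [X in measurable_fun _ X](_ : _ =
      fun t : dual_space V * Rpos => if unlift ord0 i is Some j
      then ((t.1 : 'Hom(V, R^o)) (vbasis {: V})`_j : R)
      else ln (val (t.2 : {s : R | 0 < s}))); last first.
    by apply/funext => t; rewrite mxE.
  case: unliftP => [j _|_].
    exact: (measurableT_comp (measurable_dual _) measurable_fst).
  exact: (measurableT_comp (@measurable_ln R)
    (measurableT_comp measurable_Rpos measurable_snd)).
- apply: measurable_fun_pair => /=.
    apply: measurable_dual_of_coords => i; exact: measurable_coord.
  apply: measurable_evalP => _ /=.
  by apply: measurableT_comp => //; exact: measurable_coord.
Qed.

Definition parameter_space : borel_space R :=
  @BorelSpace R _ _ standard_borel_parameters.

End parameter_borel.

End real_function_spaces.

Section kernel_of_family.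
Context (R : realType) d d' (X : measurableType d) (Y : measurableType d').
Variable P : X -> probability Y R.

Definition family_kernel
    (mP : forall A, measurable A -> measurable_fun [set: X] (fun x => P x A))
    (x : X) : {measure set Y -> \bar R} := P x.

Hypothesis mP :
  forall A, measurable A -> measurable_fun [set: X] (fun x => P x A).

HB.instance Definition _ := isKernel.Build _ _ X Y R (family_kernel mP) mP.

Let family_kernelT x : family_kernel mP x setT = 1%E.
Proof. exact: probability_setT. Qed.

HB.instance Definition _ :=
  Kernel_isProbability.Build _ _ X Y R (family_kernel mP) family_kernelT.

End kernel_of_family.

Section product_measure.
Context (R : realType) (u : finType).

Definition update (i : u) (z : measurableTypeR R * Rpow R u) : Rpow R u :=
  [ffun j => if j == i then z.1 else (z.2 : {ffun u -> R}) j].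

Lemma measurable_update i :
  measurable_fun [set: measurableTypeR R * Rpow R u] (update i).
Proof.
apply: measurable_evalP => j.
rewrite [X in measurable_fun _ X](_ : _ =
    fun z : measurableTypeR R * Rpow R u =>
    if j == i then z.1 else (z.2 : {ffun u -> R}) j); last first.
  by apply/funext => z; rewrite ffunE.
case: (j == i) => [|]; first exact: measurable_fst.
exact: (measurableT_comp (measurable_sample j) measurable_snd).
Qed.

HB.instance Definition _ i :=
  isMeasurableFun.Build _ _ _ _ (update i) (measurable_update i).

(* Starting from the Dirac mass at 0, the coordinates are drawn independently,
   one after the other; see [product_measureE]. *)
Fixpoint product_measure_seq (P : u -> probability (measurableTypeR R) R)
    (s : seq u) : probability (Rpow R u) R :=
  if s is i :: s'
  then distribution (P i \x product_measure_seq P s')%E (update i)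
  else dirac ([ffun=> 0] : Rpow R u).

Definition product_measure P := product_measure_seq P (enum u).

Lemma measurable_box (B : u -> set R) (s : seq u) :
  (forall i, measurable (B i)) ->
  measurable ([set y | forall i, i \in s -> B i ((y : {ffun u -> R}) i)]
    : set (Rpow R u)).
Proof.
move=> mB; rewrite (_ : [set _ | _] = \bigcap_(i in [set` s])
    [set y : Rpow R u | B i ((y : {ffun u -> R}) i)]); last first.
  by apply/seteqP; split=> y.
apply: fin_bigcap_measurable => // i _.
by rewrite -[X in measurable X]setTI; exact: (measurable_sample i).
Qed.

Lemma product_measureE P (B : u -> set R) : (forall i, measurable (B i)) ->
  (product_measure P [set y | forall i, B i ((y : {ffun u -> R}) i)] =
   \prod_i P i (B i))%E.
Proof.
move=> mB; rewrite /product_measure (_ : [set _ | _] =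
    [set y | forall i, i \in enum u -> B i ((y : {ffun u -> R}) i)]);
  last first.
  apply/seteqP; split=> y By i //; exact/By/mem_enum.
rewrite -big_enum/=; elim: (enum u) (enum_uniq u) =>
  [_|i s ih /= /andP[nis us]].
  rewrite big_nil /= /dirac indicE.
  by rewrite (_ : _ \in _ = true)//; apply/mem_set.
rewrite big_cons -ih// -product_measure1E; [|exact: mB|exact: measurable_box].
rewrite /distribution /pushforward /=; congr product_measure1.
apply/seteqP; split=> [[r y] By|[r y] [Br By] j] /=.
  split=> [|j js]; first by have := By i (mem_head _ _); rewrite ffunE eqxx.
  have := By j; rewrite inE js orbT ffunE => /(_ isT).
  by rewrite (negbTE (memPn nis j js)).
rewrite inE ffunE /=; case: eqP => [->//|_ /= js]; exact: By.
Qed.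

Lemma measurable_product_measure d (X : measurableType d)
    (P : X -> u -> probability (measurableTypeR R) R) :
  (forall i A, measurable A -> measurable_fun [set: X] (fun x => P x i A)) ->
  forall A, measurable A ->
    measurable_fun [set: X] (fun x => product_measure (P x) A).
Proof.
move=> mP; rewrite /product_measure; elim: (enum u) => [|i s ih] A mA /=.
  exact: measurable_cst.
have mA' : measurable (update i @^-1` A).
  by rewrite -[X in measurable X]setTI; exact: measurable_update.
rewrite /distribution /pushforward /product_measure1.
pose k1 := family_kernel (mP i).
have ih' B : measurable B -> measurable_fun [set: X * measurableTypeR R]
    (fun z => product_measure_seq (P z.1) s B).
  by move=> mB; exact: (measurableT_comp (ih _ mB) measurable_fst).
pose k2 := family_kernel ih'.
pose C : set ((X * measurableTypeR R) * Rpow R u) :=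
  [set z | A (update i (z.1.2, z.2))].
have mC : measurable C.
  rewrite -[X in measurable X]setTI.
  apply: (measurableT_comp (measurable_update i) _ _ mA) => //.
  apply: measurable_fun_pair => //.
  exact: (measurableT_comp measurable_snd measurable_fst).
pose f (z : X * measurableTypeR R) := k2 z (xsection C z).
have := @measurable_fun_integral_finite_kernel _ _ X (measurableTypeR R) R f k1.
apply.
- by move=> z; exact: measure_ge0.
- by apply: measurable_fun_xsection_finite_kernel; rewrite inE.
Qed.

End product_measure.

Section normal_family.
Context (R : realType) d (X : measurableType d).
Variables m s : X -> R.
Hypothesis (mm : measurable_fun [set: X] m) (ms : measurable_fun [set: X] s).
Hypothesis s_gt0 : forall x, 0 < s x.

Let measurable_inv d' (Y : measurableType d') (f : Y -> R) :
  (forall y, 0 <= f y) -> measurable_fun [set: Y] f ->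
  measurable_fun [set: Y] (fun y => (f y)^-1).
Proof.
move=> f0 mf; rewrite [X in measurable_fun _ X](_ : _ =
    fun y => powR (f y) (-1)).
  exact: (measurableT_comp (measurable_powR _)).
by apply/funext => y; rewrite powR_inv1.
Qed.

Let measurable_double d' (Y : measurableType d') (f : Y -> R) :
  measurable_fun [set: Y] f -> measurable_fun [set: Y] (fun y => f y *+ 2).
Proof. by move=> mf; exact: (measurable_funD mf mf). Qed.

Lemma measurable_normal_prob (A : set R) : measurable A ->
  measurable_fun [set: X] (fun x => normal_prob (m x) (s x) A).
Proof.
move=> mA.
pose f (z : X * R) : \bar R :=
  ((normal_pdf (m z.1) (s z.1) z.2)%:E * (\1_A z.2)%:E)%E.
rewrite [X in measurable_fun _ X](_ : _ =
    fun x => (\int[lebesgue_measure]_y f (x, y))%E); last first.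
  apply/funext => x; rewrite /normal_prob integral_mkcond.
  by apply: eq_integral => y _; rewrite /f/= epatch_indic.
have ms1 : measurable_fun [set: X * R] (fun z => s z.1).
  exact: (measurableT_comp ms measurable_fst).
have ms2 : measurable_fun [set: X * R] (fun z => s z.1 ^+ 2).
  exact: measurable_funX.
apply: measurable_fun_fubini_tonelli_F => [|z]; last first.
  by rewrite /f mule_ge0// lee_fin ?normal_pdf_ge0.
apply: emeasurable_funM; last first.
  by apply/measurable_EFinP; exact: (measurableT_comp _ measurable_snd).
apply/measurable_EFinP; rewrite [X in measurable_fun _ X](_ : _ =
    fun z => normal_peak (s z.1) * normal_fun (m z.1) (s z.1) z.2); last first.
  by apply/funext => z; rewrite normal_pdfE// gt_eqF.
apply: measurable_funM.
  apply: measurable_inv => [z|]; first exact: sqrtr_ge0.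
  apply: measurableT_comp.
    apply: continuous_measurable_fun; exact: sqrt_continuous.
  by apply: measurable_double; exact: measurable_funM.
apply: measurableT_comp => //; apply: measurable_funM.
  apply: measurableT_comp => //; apply: measurable_funX.
  apply: measurable_funB; first exact: measurable_snd.
  exact: (measurableT_comp mm measurable_fst).
apply: measurable_inv => [z|]; first by rewrite mulrn_wge0// sqr_ge0.
exact: measurable_double.
Qed.

End normal_family.

Section orthonormal.
Context (R : realType) (V : vectType R) (ip : {dot V for idfun}).

Definition orthonormal_basis (e : (\dim {: V}).-tuple V) :=
  basis_of {: V} e /\
  forall i j : 'I_(\dim {: V}), ip e`_i e`_j = (i == j)%:R.

Lemma ipC v w : ip v w = ip w v.
Proof. by rewrite hermC expr0 mul1r. Qed.

Let ipZl a v w : ip (a *: v) w = a * ip v w.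
Proof. exact: linearZl_LR. Qed.

Let ip_suml k (F : 'I_k -> V) w : ip (\sum_i F i) w = \sum_(i < k) ip (F i) w.
Proof. exact: linear_sumlz. Qed.

Let orthonormal_free k (s : k.-tuple V) :
  (forall i j : 'I_k, ip s`_i s`_j = (i == j)%:R) -> free s.
Proof.
move=> so; apply/freeP => c c0 i.
have : ip (\sum_j c j *: s`_j) s`_i = 0 by rewrite c0 linear0l.
rewrite ip_suml (bigD1 i)//= ipZl so eqxx mulr1 big1 ?addr0// => j ji.
by rewrite ipZl so (negbTE ji) mulr0.
Qed.

Let orthonormal_extend k (s : k.-tuple V) : (k < \dim {: V})%N ->
  (forall i j : 'I_k, ip s`_i s`_j = (i == j)%:R) ->
  exists t : k.+1.-tuple V, forall i j : 'I_k.+1, ip t`_i t`_j = (i == j)%:R.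
Proof.
move=> kn so.
have [v vs] : exists v, v \notin span s.
  apply: contrapT => /forallNP sall.
  have : ({: V} <= span s)%VS by apply/subvP => v _; apply/negPn/negP/sall.
  move=> /dimvS; rewrite leqNgt => /negP; apply.
  by rewrite (leq_ltn_trans (dim_span _))// size_tuple.
pose w := v - \sum_(i < k) ip v s`_i *: s`_i.
have w0 : w != 0.
  apply: contraNneq vs => /eqP; rewrite subr_eq0 => /eqP ->.
  by apply: memv_suml => i _; rewrite memvZ// memv_span// mem_nth ?size_tuple.
have ws (j : 'I_k) : ip w s`_j = 0.
  rewrite linearBl /= ip_suml (bigD1 j)//= ipZl so eqxx mulr1.
  rewrite big1 ?addr0 ?subrr// => i ij.
  by rewrite ipZl so (negbTE ij) mulr0.
have ww : 0 < ip w w := neq0_dnorm_gt0 _ w0.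
pose w' := (Num.sqrt (ip w w))^-1 *: w.
have w'w' : ip w' w' = 1.
  rewrite ipZl ipC ipZl mulrA -invfM -expr2 sqr_sqrtr ?ltW// mulVf//.
  by rewrite gt_eqF.
have w's (j : 'I_k) : ip w' s`_j = 0 by rewrite ipZl ws mulr0.
exists [tuple of w' :: s] => i j.
case: (unliftP ord0 i) => [i' ->|->]; case: (unliftP ord0 j) => [j' ->|->] /=.
- by rewrite so (inj_eq lift_inj).
- by rewrite ipC w's.
- by rewrite w's.
- by rewrite w'w'.
Qed.

Lemma orthonormal_basis_exists : exists e, orthonormal_basis e.
Proof.
have ex k : (k <= \dim {: V})%N -> exists s : k.-tuple V,
    forall i j : 'I_k, ip s`_i s`_j = (i == j)%:R.
  elim: k => [_|k ih kn]; first by exists [tuple] => -[].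
  have [s so] := ih (ltnW kn); exact: orthonormal_extend so.
have [e eo] := ex _ (leqnn _); exists e; split => //.
by rewrite basisEfree (orthonormal_free eo) subvf size_tuple leqnn.
Qed.

Definition orthonormal_choice := sval (cid orthonormal_basis_exists).

End orthonormal.

Section normal_law.
Context (R : realType).

Definition affine p (m : 'cV[R]_p) (L : 'M[R]_p)
    (z : Rpow R 'I_p) : Rpow R 'I_p :=
  [ffun i => m i 0 + \sum_j L i j * (z : {ffun 'I_p -> R}) j].

Lemma measurable_affine p (m : 'cV[R]_p) L : measurable_fun setT (affine m L).
Proof.
apply: measurable_evalP => i; rewrite [X in measurable_fun _ X](_ : _ =
  fun z : Rpow R 'I_p => m i 0 + \sum_j L i j * (z : {ffun 'I_p -> R}) j).
  apply: measurable_funD => //; apply: measurable_sum => j.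
  apply: measurable_funM => //; exact: measurable_sample.
by apply/funext => z; rewrite ffunE.
Qed.

HB.instance Definition _ p (m : 'cV[R]_p) L :=
  isMeasurableFun.Build _ _ _ _ (affine m L) (measurable_affine m L).

(* The normal law N(m, L L^T) on R^p. *)
Definition mvnormal p (m : 'cV[R]_p) (L : 'M[R]_p) :
    probability (Rpow R 'I_p) R :=
  distribution (product_measure (fun=> normal_prob 0 1)) (affine m L).

Variable V : vectType R.

Definition dual_of_sample (e : (\dim {: V}).-tuple V)
  (z : Rpow R 'I_(\dim {: V})) : dual_space V :=
  dual_of_coords e (z : {ffun _ -> R}).

Lemma measurable_dual_of_sample e : measurable_fun setT (dual_of_sample e).
Proof. by apply: measurable_dual_of_coords => i; exact: measurable_sample. Qed.

HB.instance Definition _ e :=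
  isMeasurableFun.Build _ _ _ _ (dual_of_sample e)
    (measurable_dual_of_sample e).

(* The law on V^* which is N(m, L L^T) in the coordinates dual to the basis e,
   that is, the values at the vectors of e. *)
Definition dual_normal e m L : probability (dual_space V) R :=
  distribution (mvnormal m L) (dual_of_sample e).

End normal_law.

Section gaussian_linear_model.
Context (R : realType).

(* The universe is the disjoint union of the coordinate spaces, so that
   subspaces of R^p and R^q are comparable only for p = q. *)
Definition subspace_obj := {p : nat & {vspace 'rV[R]_p}}.

Definition subspace_el (w : subspace_obj) : vectType R := subvs_of (tagged w).

Definition subspace_emb w (x : subspace_el w) : {p : nat & 'rV[R]_p} :=
  existT _ (tag w) (vsval x).

Lemma subspace_emb_inj w : injective (@subspace_emb w).
Proof. by move=> x y xy; apply: val_inj; exact: (eq_from_Tagged xy). Qed.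

Definition subspace_category : covariate_category.
Proof.
refine (@CovariateCategory subspace_obj subspace_el _ subspace_emb
  subspace_emb_inj (fun w w' => 'Hom(subspace_el w, subspace_el w'))
  (fun w w' f => f) _ (fun w => \1%VF) _ (fun a b c g f => (g \o f)%VF) _).
- by move=> w w' f g /= fg; apply/lfunP => x; rewrite fg.
- by move=> w x; rewrite id_lfunE.
- by move=> a b c g f x; rewrite comp_lfunE.
Defined.

Definition par_pullback (w w' : subspace_obj)
    (psi : 'Hom(subspace_el w, subspace_el w'))
    (t : dual_space (subspace_el w') * Rpos R) :
    dual_space (subspace_el w) * Rpos R :=
  (((t.1 : 'Hom(_, R^o)) \o psi)%VF, t.2).

Lemma measurable_par_pullback w w' (psi : 'Hom(subspace_el w, subspace_el w')) :
  measurable_fun setT (par_pullback psi).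
Proof.
apply: measurable_fun_pair; last exact: measurable_snd.
apply: measurable_evalP => v; rewrite [X in measurable_fun _ X](_ : _ =
  fun t : dual_space (subspace_el w') * Rpos R =>
    (t.1 : 'Hom(_, R^o)) (psi v) : R).
  exact: (measurableT_comp (measurable_dual _) measurable_fst).
by apply/funext => t; rewrite comp_lfunE.
Qed.

HB.instance Definition _ w w' (psi : 'Hom(subspace_el w, subspace_el w')) :=
  isMeasurableFun.Build _ _ _ _ (par_pullback psi)
    (measurable_par_pullback psi).

Definition gaussian_parameters : parameter_functor R subspace_category.
Proof.
refine (@ParameterFunctor R subspace_category
  (fun w => parameter_space (subspace_el w))
  (fun w w' psi => par_pullback psi) _ _).
- move=> w [beta s]; congr pair; apply/lfunP => v.
  by rewrite comp_lfunE id_lfunE.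
- move=> a b c g f [beta s]; congr pair; apply/lfunP => v.
  by rewrite !comp_lfunE.
Defined.

Record design := Design {
  unit_set : finType ;
  covariate_space : subspace_obj ;
  regressor : unit_set -> subspace_el covariate_space }.

(* [normal_prob] takes the standard deviation, and t.2 is the variance. *)
Definition response_law d (t : gaussian_parameters (covariate_space d)) :
    probability (sample_space R (unit_set d)) R :=
  product_measure (fun i => normal_prob
    ((t.1 : 'Hom(_, R^o)) (regressor i))
    (Num.sqrt (val (t.2 : {s : R | 0 < s})))).

Lemma measurable_response_law d A : measurable A ->
  measurable_fun setT (fun t => @response_law d t A).
Proof.
apply: measurable_product_measure => i B mB.
apply: measurable_normal_prob => //.
- exact: (measurableT_comp (measurable_dual _) measurable_fst).
- have msqrt : measurable_fun [set: R] (@Num.sqrt R).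
    by apply: continuous_measurable_fun; exact: sqrt_continuous.
  exact: (measurableT_comp msqrt
    (measurableT_comp (@measurable_Rpos R) measurable_snd)).
- by move=> t; rewrite sqrtr_gt0 (valP (t.2 : {s : R | 0 < s})).
Qed.

Definition gaussian_model d :
    R.-pker (gaussian_parameters (covariate_space d))
            ~> sample_space R (unit_set d) :=
  family_kernel (@measurable_response_law d).

Definition inner_products :=
  forall w : subspace_obj, {dot subspace_el w for idfun}.

Definition restricts_along_insertions (ip : inner_products) :=
  forall p (U V : {vspace 'rV[R]_p}), (U <= V)%VS ->
    forall (v w : subvs_of U) (v' w' : subvs_of V),
      vsval v = vsval v' -> vsval w = vsval w' ->
      ip (existT _ p U) v w = ip (existT _ p V) v' w'.

Definition known_variance (s2 : R) (s2_gt0 : 0 < s2) : Rpos R :=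
  exist _ s2 s2_gt0.

(* [orthonormal_choice] is some orthonormal basis: the law does not depend on
   which, by the invariance of N(0, tau2 I) under orthogonal matrices. *)
Definition ridge_prior (ip : inner_products) (s2 tau2 : R) (s2_gt0 : 0 < s2) :
    prior gaussian_parameters := fun w =>
  (dual_normal (orthonormal_choice (ip w)) 0 (Num.sqrt tau2)%:M
    \x \d_(known_variance s2_gt0))%E.

Definition design_matrix d
    (e : (\dim {: subspace_el (covariate_space d)}).-tuple _) :
    'M[R]_(#|unit_set d|, \dim {: subspace_el (covariate_space d)}) :=
  \matrix_(i, j) coord e j (regressor (enum_val i)).

Definition ridge_estimator d e (lambda : R) (y : sample_space R (unit_set d)) :=
  let X := @design_matrix d e in
  invmx (X^T *m X + lambda%:M) *m X^T *m
    \col_i (y : {ffun unit_set d -> R}) (enum_val i).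

End gaussian_linear_model.

(* Main.v *)
Require Import Defs.
From HB Require Import structures.
From mathcomp Require Import all_boot all_order all_algebra.
From mathcomp Require Import sesquilinear.
From mathcomp Require Import all_classical all_reals all_analysis.
From mathcomp Require Import giry measurable_realfun.
From mathcomp Require Import ring lra.

Set Implicit Arguments.
Unset Strict Implicit.
Unset Printing Implicit Defensive.
Import Order.TTheory GRing.Theory Num.Theory.
Import numFieldNormedType.Exports.

Local Open Scope classical_set_scope.
Local Open Scope ring_scope.

(** Coherence of a prior at [f : a -> b] says that [pi a] is the image of [pi b]
    under the map induced by [f].  So [pi a] gives no mass to what the map
    misses, and when [f] is an automorphism the statement is the invariance
    itself; the insertions alone cannot force it, since a category may have an
    automorphism and no insertion at all.

    Everything about the Gaussian model reduces to one fact: the law of [A z],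
    for a standard Gaussian vector [z], depends on the matrix [A] only through
    the covariance [A A^T], assumed invertible ([gauss_cov_eq]).  It is derived from the invariance
    of the standard Gaussian law under orthogonal matrices.  In the plane,
    a rotation of nonzero sine is a product of three shears; shears preserve Lebesgue measure
    by Tonelli and translation invariance, and the density only sees the norm
    ([normal_plane_rotation]).  In higher dimension an orthogonal matrix is
    reduced to the identity by plane rotations, which kill the entries of a
    column one at a time, and by changes of sign
    ([orthogonal_gauss_rotation]).  Two matrices [A] and [B] with the same
    invertible covariance [K] satisfy [B = A U] for the partial isometry
    [U = A^T K^-1 B], and [U] is a block of an orthogonal matrix.

    Bayesian inversion: a kernel inverts the model as soon as drawing the
    parameter and then the response gives the same joint law as drawing the
    response and then the parameter from the kernel
    ([bayesian_inversion_of_joint]).  For the ridge posterior both joint laws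
    are linear images of standard Gaussian vectors, and their covariances agree
    by the normal equations ([posterior_covariance]).

    Coherence: in orthonormal coordinates the pullback along a linear map is
    the matrix of that map transposed, whose rows are orthonormal when the map
    is an isometry; so the prior is coherent at isometries, in particular at
    the insertions.  Conversely the evaluation at [v] of a random functional is
    a centred normal variable with variance [tau2 |v|^2], so that coherence at
    a linear map forces it to preserve norms ([ridge_prior_coherent_isometry]).
    Multiplication by 2 on a line is an isomorphism which does not. *)

(** * Coherence of priors *)

Section coherence.
Context (R : realType) (Om : covariate_category) (Theta : parameter_functor R Om).
Variable pi : prior Theta.

Lemma coherent_at_null a b (f : @cov_hom Om a b) (A : set (Theta a)) :
  coherent_at pi f -> measurable A -> A `&` range (par_map Theta f) = set0 ->
  pi a A = 0%E.
Proof.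
move=> cf mA A0; rewrite cf// -[LHS]/(pi b (par_map Theta f @^-1` A)).
rewrite (_ : _ @^-1` _ = set0) ?measure0//.
apply/seteqP; split=> t //= At.
have : (A `&` range (par_map Theta f)) (par_map Theta f t) by split=> //; exists t.
by rewrite A0.
Qed.

Lemma coherent_at_id a : coherent_at pi (cov_id a).
Proof.
move=> S mS; rewrite /distribution /pushforward/=; congr (pi a _).
by apply/seteqP; split=> t /=; rewrite par_id.
Qed.

(** Both the parameter maps and the pushforwards compose, so that coherence
    over a generated subcategory has only to be checked on the generators. *)
Lemma coherent_at_comp a b c (g : @cov_hom Om b c) (f : cov_hom a b) :
  coherent_at pi g -> coherent_at pi f -> coherent_at pi (cov_comp g f).
Proof.
move=> cg cf S mS.
have mfS : measurable (par_map Theta f @^-1` S).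
  by rewrite -[X in measurable X]setTI; exact: measurable_funP.
rewrite cf// -[LHS]/(pi b (par_map Theta f @^-1` S)) cg//.
rewrite -[LHS]/(pi c (par_map Theta g @^-1` (par_map Theta f @^-1` S))).
by congr (pi c _); apply/seteqP; split=> t /=; rewrite par_comp.
Qed.

Lemma coherent_over_generated (Q : hom_class Om) :
  coherent_over pi Q -> coherent_over pi (generated Q).
Proof.
move=> cQ a b f; elim=> {a b f} [a b f /cQ//|a|a b c g f _ cg _ cf].
  exact: coherent_at_id.
exact: coherent_at_comp.
Qed.

Lemma coherent_over_inj_invariant :
  coherent_over pi (@Omega_inj Om) -> Aut_invariant pi.
Proof.
move=> ci a f isof S mS; apply/esym/ci => //.
by apply: gen_base; right.
Qed.

End coherence.

Section swap.
Context (R : realType).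

(** The full transformation monoid of a two-point set: it contains the swap, but
    no insertion, since no object is properly included in another. *)
Definition bool_category : covariate_category.
Proof.
refine (@CovariateCategory unit (fun=> bool) bool (fun=> id) _
  (fun _ _ => bool -> bool) (fun _ _ => id) _ (fun=> id) _
  (fun _ _ _ g f => g \o f) _); by move=> /= *.
Defined.

Lemma measurable_precomp (f : bool -> bool) : measurable_fun setT
  (fun y : Rpow R bool => [ffun i => (y : {ffun _ -> R}) (f i)] : Rpow R bool).
Proof.
apply: measurable_evalP => i.
rewrite (_ : (fun _ => _) = fun y : Rpow R bool => (y : {ffun _ -> R}) (f i)).
  exact: measurable_sample.
by apply/funext => y; rewrite ffunE.
Qed.

Definition bool_functor : parameter_functor R bool_category.
Proof.
refine (@ParameterFunctor R bool_category (fun=> sample_space R bool)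
  (fun a b f => HB.pack (fun y : Rpow R bool =>
    [ffun i => (y : {ffun _ -> R}) (f i)] : Rpow R bool)
    (isMeasurableFun.Build _ _ _ _ _ (measurable_precomp f))) _ _).
- by move=> a t; apply/ffunP => i; rewrite ffunE.
- by move=> a b c g f t; apply/ffunP => i; rewrite !ffunE.
Defined.

Definition dirac_prior : prior bool_functor :=
  fun=> \d_([ffun b : bool => (b : nat)%:R] : Rpow R bool).

Lemma dirac_prior_coherent : coherent_over dirac_prior (@Omega_red bool_category).
Proof.
by apply: coherent_over_generated => -[] [] f [_ [y /(_ y)]].
Qed.

Lemma dirac_prior_not_invariant : ~ Aut_invariant dirac_prior.
Proof.
move=> inv; pose swap : @cov_hom bool_category tt tt := negb.
have iso_swap : iso swap.
  by exists swap; split; apply/funext => b /=; rewrite /swap negbK.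
pose S : set (Rpow R bool) := [set y | (y : {ffun _ -> R}) true = 1].
have mS : measurable S.
  rewrite [X in measurable X](_ : _ =
    setT `&` (fun y : Rpow R bool => (y : {ffun _ -> R}) true) @^-1` [set 1]).
    exact: measurable_sample.
  by rewrite setTI.
pose pt : Rpow R bool := [ffun b : bool => (b : nat)%:R].
have : \d_pt (par_map bool_functor swap @^-1` S) = \d_pt S :> \bar R.
  exact: inv iso_swap S mS.
rewrite !diracE.
rewrite memNset; last by rewrite /S/= !ffunE/= => /eqP; rewrite eq_sym oner_eq0.
rewrite mem_set; last by rewrite /S/= ffunE.
by move=> /eqP; rewrite eqe eq_sym oner_eq0.
Qed.

End swap.

(** * Affine changes of variable on the line *)

Section lebesgue_affine.
Context (R : realType).
Notation mu := (@lebesgue_measure R).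

Lemma affine_preimage_itv (m s a b : R) : 0 < s ->
  (fun x => m + s * x) @^-1` `]a, b] = `](a - m) / s, (b - m) / s]%classic.
Proof.
move=> s0; apply/seteqP; split => x /=; rewrite !in_itv/=;
  by rewrite ltr_pdivrMr// ler_pdivlMr// ltrBlDl lerBrDl (mulrC s).
Qed.

Lemma measurable_affine_line (m s : R) :
  measurable_fun setT (fun x : measurableTypeR R => m + s * x : measurableTypeR R).
Proof. by apply: measurable_funD => //; exact: measurable_funM. Qed.

Lemma measurable_preimage_mull (r : R) (B : set R) : measurable B ->
  measurable [set x | B (r * x)].
Proof.
move=> mB; rewrite [X in measurable X](_ : _ = setT `&` (fun x => r * x) @^-1` B).
  by apply: (measurable_funM (measurable_cst r) (@measurable_id _ _ setT)).
by rewrite setTI.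
Qed.

Lemma lebesgue_measure_affine (m s : R) (s0 : 0 < s) (A : set R) :
  measurable A ->
  mu A = (s%:E * mu ((fun x => m + s * x)%R @^-1` A))%E.
Proof.
move=> mA.
apply: (@lebesgue_measure_unique R (mscale (NngNum (ltW s0)) (pushforward mu
  (fun x : measurableTypeR R => m + s * x : measurableTypeR R))) _ A mA).
  exact: measurable_affine_line.
move=> ? _ [[a b]] _ <-.
rewrite -[RHS]/(s%:E * mu ((fun x => m + s * x)%R @^-1` `]a, b]%classic))%E.
rewrite affine_preimage_itv// !lebesgue_measure_itv/=.
rewrite !lte_fin ltr_pM2r ?invr_gt0// ltrD2r.
case: ifPn => [ab|]; last by rewrite mule0.
by rewrite -!EFinB -EFinM -mulrBl mulrC divfK ?gt_eqF// opprB addrA subrK.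
Qed.

Lemma ge0_integral_affine (m s : R) (f : R -> \bar R) : 0 < s ->
  measurable_fun setT f -> (forall x, 0 <= f x)%E ->
  (\int[mu]_x f x = s%:E * \int[mu]_x f (m + s * x)%R)%E.
Proof.
move=> s0 mf f0.
rewrite (@eq_measure_integral _ _ _ setT (mscale (NngNum (ltW s0))
  (pushforward mu (fun x : measurableTypeR R => m + s * x : measurableTypeR R)))).
- exact: measurable_affine_line.
- move=> mg; rewrite ge0_integral_mscale//= ge0_integral_pushforward//=.
- by move=> mg /= A mA _; rewrite (lebesgue_measure_affine m s0 mA).
Qed.

End lebesgue_affine.

Section standard_normal.
Context (R : realType).
Notation mu := (@lebesgue_measure R).
Notation N01 := (normal_prob 0 1 : probability (measurableTypeR R) R).
Notation phi := (normal_pdf (0 : R) 1).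

Lemma measurable_normal_pdf_restrict (m s : R) (B : set R) : measurable B ->
  measurable_fun setT ((fun x => (normal_pdf m s x)%:E) \_ B).
Proof.
move=> mB; apply/(measurable_restrictT (fun x => (normal_pdf m s x)%:E) mB).
apply: measurable_funTS; apply/measurable_EFinP.
exact: measurable_normal_pdf.
Qed.

Lemma normal_pdf_restrict_ge0 (m s : R) (B : set R) x :
  (0 <= ((fun x => (normal_pdf m s x)%:E) \_ B) x)%E.
Proof. by rewrite patchE; case: ifP => // _; rewrite lee_fin normal_pdf_ge0. Qed.

Lemma normal_prob_affine (m s : R) (B : set R) : 0 < s -> measurable B ->
  normal_prob m s B = N01 ((fun x => m + s * x) @^-1` B).
Proof.
move=> s0 mB.
have mB' : measurable ((fun x => m + s * x) @^-1` B).
  by rewrite -[X in measurable X]setTI; exact: (@measurable_affine_line R m s).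
rewrite /= /normal_prob integral_mkcond [RHS]integral_mkcond.
rewrite (@ge0_integral_affine _ m s)//.
- rewrite -ge0_integralZl//.
  + apply: eq_integral => x _; rewrite !patchE/=.
    rewrite (_ : (m + s * x \in B) = (x \in (fun x => m + s * x) @^-1` B)).
      case: ifPn => _; last by rewrite mule0.
      rewrite -EFinM !normal_pdfE ?oner_eq0 ?gt_eqF//; congr EFin.
      rewrite /normal_peak /normal_fun mulrA; congr (_ * expR _).
        rewrite expr1n mul1r -mulrnAr sqrtrM ?sqr_ge0// sqrtr_sqr gtr0_norm//.
        by rewrite invfM mulrA mulfV ?gt_eqF// mul1r.
      rewrite addrAC subrr add0r subr0 expr1n exprMn -mulr_natr.
      by field; rewrite gt_eqF.
    by apply/idP/idP; rewrite !inE.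
  + exact: measurableT_comp (measurable_normal_pdf_restrict m s mB)
      (@measurable_affine_line R m s).
  + by move=> x _; exact: normal_pdf_restrict_ge0.
  + exact: ltW.
- exact: measurable_normal_pdf_restrict.
- by move=> x; exact: normal_pdf_restrict_ge0.
Qed.

(** Radon-Nikodym derivatives being unique almost everywhere, the abstract
    derivative of the normal law can be replaced by its density. *)
Lemma ge0_integral_normal (f : R -> \bar R) :
  measurable_fun setT f -> (forall x, 0 <= f x)%E ->
  (\int[N01]_x f x = \int[mu]_x (f x * (phi x)%:E))%E.
Proof.
move=> mf f0.
have dom := normal_prob_dominates (0 : R) 1.
rewrite -(Radon_Nikodym_SigmaFinite.change_of_variables dom)//.
have iRN := Radon_Nikodym_SigmaFinite.f_integrable dom.
apply: ae_eq_integral => //.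
- by apply: emeasurable_funM => //; exact: measurable_int iRN.
- apply: emeasurable_funM => //; apply/measurable_EFinP.
  exact: measurable_normal_pdf.
- apply: ae_eqe_mul2l; apply: integral_ae_eq => //.
    by apply/measurable_EFinP; exact: measurable_normal_pdf.
  by move=> E _ mE; rewrite -Radon_Nikodym_SigmaFinite.f_integral.
Qed.

End standard_normal.

(** * Rotations of the plane *)

Section planar_rotation.
Context (R : realType).
Notation mu := (@lebesgue_measure R).
Notation N01 := (normal_prob 0 1 : probability (measurableTypeR R) R).
Notation phi := (normal_pdf (0 : R) 1).
Notation plane := (measurableTypeR R * measurableTypeR R)%type.

(** Integrated first along the direction of the shear, this is the translation
    invariance of Lebesgue measure. *)
Lemma ge0_integral_shearx (t : R) (f : plane -> \bar R) :
  measurable_fun setT f -> (forall z, 0 <= f z)%E ->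
  (\int[mu \x mu]_z f (z.1 + t * z.2, z.2)%R = \int[mu \x mu]_z f z)%E.
Proof.
move=> mf f0.
have mg : measurable_fun setT (fun z : plane => f (z.1 + t * z.2, z.2)).
  apply: measurableT_comp mf _; apply: measurable_fun_pair => //=.
  by apply: measurable_funD => //; apply: measurable_funM.
rewrite !fubini_tonelli2//; apply: eq_integral => y _; rewrite /fubini_G/=.
rewrite [RHS](@ge0_integral_affine _ (t * y) 1)//.
  by rewrite mul1e; apply: eq_integral => x _; rewrite mul1r addrC.
by apply: measurableT_comp mf _; exact: measurable_fun_pair.
Qed.

Lemma ge0_integral_sheary (t : R) (f : plane -> \bar R) :
  measurable_fun setT f -> (forall z, 0 <= f z)%E ->
  (\int[mu \x mu]_z f (z.1, z.2 + t * z.1)%R = \int[mu \x mu]_z f z)%E.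
Proof.
move=> mf f0.
have mg : measurable_fun setT (fun z : plane => f (z.1, z.2 + t * z.1)).
  apply: measurableT_comp mf _; apply: measurable_fun_pair => //=.
  by apply: measurable_funD => //; apply: measurable_funM.
rewrite !fubini_tonelli1//; apply: eq_integral => x _; rewrite /fubini_F/=.
rewrite [RHS](@ge0_integral_affine _ (t * x) 1)//.
  by rewrite mul1e; apply: eq_integral => y _; rewrite mul1r addrC.
by apply: measurableT_comp mf _; exact: measurable_fun_pair.
Qed.

Definition rotation (c s : R) (z : plane) : plane :=
  (c * z.1 - s * z.2, s * z.1 + c * z.2).

Lemma measurable_rotation c s : measurable_fun setT (rotation c s).
Proof.
by apply: measurable_fun_pair => /=; [apply: measurable_funB|apply: measurable_funD];
  apply: measurable_funM.
Qed.

(** A rotation of angle [u] outside of [pi Z] is the product of three shears, with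
    slopes [- tan (u / 2)], [sin u] and [- tan (u / 2)] again; the hypothesis
    [s != 0] is what makes the slope [(c - 1) / s] meaningful. *)
Lemma ge0_integral_rotation c s (f : plane -> \bar R) :
  c ^+ 2 + s ^+ 2 = 1 -> s != 0 ->
  measurable_fun setT f -> (forall z, 0 <= f z)%E ->
  (\int[mu \x mu]_z f (rotation c s z) = \int[mu \x mu]_z f z)%E.
Proof.
move=> cs s0 mf f0; pose a := (c - 1) / s.
have mS1 (g : plane -> \bar R) : measurable_fun setT g ->
    measurable_fun setT (fun z : plane => g (z.1 + a * z.2, z.2)).
  move=> mg; apply: measurableT_comp mg _; apply: measurable_fun_pair => //=.
  by apply: measurable_funD => //; apply: measurable_funM.
have mS2 (g : plane -> \bar R) : measurable_fun setT g ->
    measurable_fun setT (fun z : plane => g (z.1, z.2 + s * z.1)).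
  move=> mg; apply: measurableT_comp mg _; apply: measurable_fun_pair => //=.
  by apply: measurable_funD => //; apply: measurable_funM.
rewrite -[RHS](ge0_integral_shearx a)//.
rewrite -[RHS](ge0_integral_sheary s)//; last exact: mS1.
rewrite -[RHS](ge0_integral_shearx a)//; last exact: mS2 (mS1 _ mf).
apply: eq_integral => -[x y] _; rewrite /rotation/=; congr (f (_, _)).
  have -> : c * x - s * y = c * x + (c ^+ 2 - 1) / s * y.
    by rewrite -cs; field.
  by rewrite /a; field.
by rewrite /a; field.
Qed.

Lemma normal_pdf_planeE (z : plane) :
  phi z.1 * phi z.2 = normal_peak 1 ^+ 2 * expR (- (z.1 ^+ 2 + z.2 ^+ 2) / 2).
Proof.
rewrite !normal_pdfE ?oner_eq0// /normal_fun mulrACA -expr2 -expRD; congr (_ * expR _).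
by rewrite !subr0 expr1n -mulrDl opprD.
Qed.

Definition normal_plane : probability plane R := (N01 \x N01)%E.

Lemma normal_planeE (A : set plane) : measurable A ->
  (normal_plane A = \int[mu \x mu]_z (\1_A z * (phi z.1 * phi z.2))%:E)%E.
Proof.
move=> mA.
have m1 : measurable_fun setT (fun z : plane => phi z.1).
  by apply: measurableT_comp => //; exact: measurable_normal_pdf.
have m2 : measurable_fun setT (fun z : plane => phi z.2).
  by apply: measurableT_comp => //; exact: measurable_normal_pdf.
rewrite fubini_tonelli1; last 2 first.
- by apply/measurable_EFinP; do 2 apply: measurable_funM => //.
- by move=> z; rewrite lee_fin mulr_ge0// mulr_ge0 ?normal_pdf_ge0.
rewrite [LHS](ge0_integral_normal (f := N01 \o xsection A))//; last first.
  exact: measurable_fun_xsection.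
apply: eq_integral => x _; rewrite /fubini_F/= -(setIT (xsection A x)).
rewrite -integral_indic//; last exact: measurable_xsection.
rewrite (@ge0_integral_normal R (fun y => (\1_(xsection A x) y)%:E)); last 2 first.
- by apply/measurable_EFinP/measurable_indic; exact: measurable_xsection.
- by move=> y; rewrite lee_fin.
rewrite -ge0_integralZr//.
- apply: eq_integral => y _; rewrite -!EFinM; congr EFin.
  by rewrite !indicE mem_xsection; ring.
- apply: emeasurable_funM; last by apply/measurable_EFinP; exact: measurable_normal_pdf.
  by apply/measurable_EFinP/measurable_indic; exact: measurable_xsection.
- by move=> y _; rewrite mule_ge0// lee_fin ?normal_pdf_ge0.
- by rewrite lee_fin normal_pdf_ge0.
Qed.

(** The density of the planar normal law is a function of the norm, hence its
    invariance under rotations is that of Lebesgue measure. *)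
Lemma normal_plane_rotation c s (A : set plane) :
  c ^+ 2 + s ^+ 2 = 1 -> s != 0 -> measurable A ->
  normal_plane (rotation c s @^-1` A) = normal_plane A.
Proof.
move=> cs s0 mA.
have mrA : measurable (rotation c s @^-1` A).
  by rewrite -[X in measurable X]setTI; exact: measurable_rotation.
rewrite !normal_planeE// -[RHS](ge0_integral_rotation cs s0); last 2 first.
- apply/measurable_EFinP; apply: measurable_funM => //.
  by apply: measurable_funM; apply: measurableT_comp => //; exact: measurable_normal_pdf.
- by move=> z; rewrite lee_fin mulr_ge0// mulr_ge0 ?normal_pdf_ge0.
apply: eq_integral => z _; rewrite !normal_pdf_planeE.
have -> : (rotation c s z).1 ^+ 2 + (rotation c s z).2 ^+ 2 = z.1 ^+ 2 + z.2 ^+ 2.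
  by rewrite -[RHS]mul1r -cs /=; ring.
by rewrite !indicE.
Qed.

Lemma normalN (A : set R) : measurable A -> N01 (-%R @^-1` A) = N01 A.
Proof.
move=> mA.
have mNA : measurable (-%R @^-1` A : set R).
  by rewrite -[X in measurable X]setTI; exact: oppr_measurable.
rewrite /= /normal_prob [RHS]integral_mkcond.
rewrite (@eq_measure_integral _ _ _ setT
  (pushforward mu (-%R : measurableTypeR R -> measurableTypeR R))).
- rewrite ge0_integral_pushforward//=.
  + rewrite integral_mkcond; apply: eq_integral => x _; rewrite !patchE/=.
    rewrite (_ : (- x \in A) = (x \in -%R @^-1` A)).
      case: ifP => // _; rewrite !normal_pdfE ?oner_eq0//.
      by rewrite /normal_fun !subr0 sqrrN.
    by apply/idP/idP; rewrite !inE.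
  + exact: measurable_normal_pdf_restrict.
  + by move=> x _; exact: normal_pdf_restrict_ge0.
- by move=> B mB _; exact/esym/lebesgue_measureN.
Qed.

End planar_rotation.

(** * The standard Gaussian law *)

Section boxes.
Context (R : realType) (u : finType).

Definition box (B : u -> set R) : set (Rpow R u) :=
  [set y | forall i, B i ((y : {ffun u -> R}) i)].

Lemma measurable_boxT (B : u -> set R) :
  (forall i, measurable (B i)) -> measurable (box B).
Proof.
move=> mB; rewrite (_ : box B =
    [set y | forall i, i \in enum u -> B i ((y : {ffun u -> R}) i)]).
  exact: measurable_box.
by apply/seteqP; split=> y By i //; exact/By/mem_enum.
Qed.

(** The boxes are stable under intersection and generate the sigma-algebra of the
    evaluations. *)
Lemma eq_probability_box (P Q : probability (Rpow R u) R) :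
  (forall B : u -> set R, (forall i, measurable (B i)) ->
    P (box B) = Q (box B)) -> P ≡μ Q.
Proof.
move=> PQ A mA.
pose G := [set box B | B in [set B : u -> set R | forall i, measurable (B i)]].
have GT : G setT by exists (fun=> setT) => //; apply/seteqP; split.
apply: (@g_sigma_algebra_measure_unique _ R _ G _ (fun=> setT)) => //.
- by move=> _ [B mB <-]; exact: measurable_boxT.
- by rewrite bigcup_const//; exists 0.
- move=> _ _ [B mB <-] [C mC <-]; exists (fun i => B i `&` C i).
    by move=> i /=; exact: measurableI.
  apply/seteqP; split=> y; first by move=> BC; split=> i; have [] := BC i.
  by move=> [By Cy] i; split; [exact: By|exact: Cy].
- by move=> _ [B mB <-]; exact: PQ.
- by move=> n; rewrite -ge0_fin_numE// fin_num_measure.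
- move: A mA; apply: smallest_sub; first exact: smallest_sigma_algebra.
  move=> _ [i [B [mB ->]]]; apply: sub_gen_smallest.
  (* An evaluation event is a box with all other sides full. *)
  exists (fun j => if j == i then B else setT).
    by move=> j /=; case: ifP.
  apply/seteqP; split=> [y /(_ i)|y By j]; first by rewrite eqxx.
  by case: eqP => // ->.
Qed.

End boxes.

Section standard_gaussian.
Context (R : realType).
Notation N01 := (normal_prob 0 1 : probability (measurableTypeR R) R).

Definition gauss n : probability (Rpow R 'I_n) R :=
  product_measure (fun=> normal_prob 0 1).

Lemma gauss_box n (B : 'I_n -> set R) : (forall i, measurable (B i)) ->
  gauss n (box B) = (\prod_i N01 (B i))%E.
Proof. exact: (@product_measureE R 'I_n (fun=> N01)). Qed.

Definition to_col n (z : Rpow R 'I_n) : 'cV[R]_n :=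
  \col_i (z : {ffun 'I_n -> R}) i.

Definition of_col n (c : 'cV[R]_n) : Rpow R 'I_n := [ffun i => c i 0].

Lemma to_colK n : cancel (@to_col n) (@of_col n).
Proof. by move=> z; apply/ffunP => i; rewrite ffunE mxE. Qed.

Lemma of_colK n : cancel (@of_col n) (@to_col n).
Proof. by move=> c; apply/colP => i; rewrite mxE ffunE. Qed.

Lemma measurable_of_col d (T : measurableType d) n (f : T -> 'cV[R]_n) :
  (forall i, measurable_fun setT (fun x => f x i 0)) ->
  measurable_fun setT (fun x => of_col (f x)).
Proof.
move=> mf; apply: measurable_evalP => i.
by rewrite (_ : (fun _ => _) = fun x => f x i 0)//; apply/funext => x; rewrite ffunE.
Qed.

Lemma measurable_to_col n i :
  measurable_fun setT (fun z : Rpow R 'I_n => to_col z i 0).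
Proof.
rewrite (_ : (fun _ => _) = fun z : Rpow R 'I_n => (z : {ffun _ -> R}) i).
  exact: measurable_sample.
by apply/funext => z; rewrite mxE.
Qed.

Lemma measurable_mulmx d (T : measurableType d) m n (A : 'M[R]_(m, n))
    (f : T -> 'cV[R]_n) :
  (forall i, measurable_fun setT (fun x => f x i 0)) ->
  forall i, measurable_fun setT (fun x => (A *m f x) i 0).
Proof.
move=> mf i; rewrite (_ : (fun _ => _) = fun x => \sum_j A i j * f x j 0).
  by apply: measurable_sum => j; apply: measurable_funM.
by apply/funext => x; rewrite mxE.
Qed.

Definition lin m n (A : 'M[R]_(m, n)) (z : Rpow R 'I_n) : Rpow R 'I_m :=
  of_col (A *m to_col z).

Lemma measurable_lin m n (A : 'M[R]_(m, n)) : measurable_fun setT (lin A).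
Proof.
by apply: measurable_of_col; apply: measurable_mulmx => i; exact: measurable_to_col.
Qed.

Lemma lin_comp m n p (A : 'M[R]_(m, n)) (B : 'M[R]_(n, p)) z :
  lin A (lin B z) = lin (A *m B) z.
Proof. by rewrite /lin of_colK mulmxA. Qed.

Lemma lin1 n (z : Rpow R 'I_n) : lin 1%:M z = z.
Proof. by rewrite /lin mul1mx to_colK. Qed.

Definition concat m n (z : Rpow R 'I_m * Rpow R 'I_n) : Rpow R 'I_(m + n) :=
  of_col (col_mx (to_col z.1) (to_col z.2)).

Lemma measurable_concat m n : measurable_fun setT (@concat m n).
Proof.
apply: measurable_of_col => i; case: (split_ordP i) => j ->.
  rewrite (_ : (fun _ => _) = (fun z => to_col z j 0) \o fst).
    by apply: measurableT_comp; [exact: measurable_to_col|exact: measurable_fst].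
  by apply/funext => z; rewrite col_mxEu.
rewrite (_ : (fun _ => _) = (fun z => to_col z j 0) \o snd).
  by apply: measurableT_comp; [exact: measurable_to_col|exact: measurable_snd].
by apply/funext => z; rewrite col_mxEd.
Qed.

HB.instance Definition _ m n :=
  isMeasurableFun.Build _ _ _ _ (@concat m n) (@measurable_concat m n).

Lemma gauss_concat m n (A : set (Rpow R 'I_(m + n))) : measurable A ->
  gauss (m + n) A = (gauss m \x gauss n)%E (@concat m n @^-1` A).
Proof.
move: A; apply: (@eq_probability_box R _ _
  (distribution (gauss m \x gauss n)%E (@concat m n))) => B mB.
rewrite gauss_box//= /distribution /pushforward/=.
rewrite (_ : _ @^-1` _ = box (B \o @lshift m n) `*` box (B \o @rshift m n)).
  rewrite product_measure1E//; last 2 first.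
  - by apply: measurable_boxT => i; exact: mB.
  - by apply: measurable_boxT => i; exact: mB.
  rewrite [X in (X * _)%E]gauss_box; last by move=> i; exact: mB.
  rewrite [X in (_ * X)%E]gauss_box; last by move=> i; exact: mB.
  by rewrite big_split_ord.
apply/seteqP; split=> [z Bz|z [B1 B2] i] /=.
  split=> i /=.
    by have := Bz (lshift n i); rewrite /concat/= ffunE col_mxEu mxE.
  by have := Bz (rshift m i); rewrite /concat/= ffunE col_mxEd mxE.
rewrite /concat/= ffunE; case: (split_ordP i) => j ->.
  by rewrite col_mxEu mxE; exact: B1.
by rewrite col_mxEd mxE; exact: B2.
Qed.

Section coordinate_plane.
Variables (n : nat) (i j : 'I_n).
Hypothesis ij : i != j.

(** Redrawing two coordinates of a Gaussian vector isolates a plane in which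
    [normal_plane_rotation] applies, the other coordinates being a parameter. *)
Definition replace2 (z : Rpow R 'I_n * (measurableTypeR R * measurableTypeR R)) :
    Rpow R 'I_n :=
  [ffun k => if k == i then z.2.1 else if k == j then z.2.2
             else (z.1 : {ffun _ -> R}) k].

Lemma measurable_replace2 : measurable_fun setT replace2.
Proof.
apply: measurable_evalP => k.
rewrite [X in measurable_fun _ X](_ : _ = fun z => if k == i then z.2.1
    else if k == j then z.2.2 else (z.1 : {ffun _ -> R}) k); last first.
  by apply/funext => z; rewrite ffunE.
case: (k == i); first exact: (measurableT_comp measurable_fst measurable_snd).
case: (k == j); first exact: (measurableT_comp measurable_snd measurable_snd).
exact: (measurableT_comp (measurable_sample k) measurable_fst).
Qed.

HB.instance Definition _ :=
  isMeasurableFun.Build _ _ _ _ replace2 measurable_replace2.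

Lemma gauss_replace2 (A : set (Rpow R 'I_n)) : measurable A ->
  gauss n A = (gauss n \x normal_plane R)%E (replace2 @^-1` A).
Proof.
move: A; apply: (@eq_probability_box R _ _
  (distribution (gauss n \x normal_plane R)%E replace2)) => B mB.
pose B' k := if (k == i) || (k == j) then setT else B k.
have mB' k : measurable (B' k) by rewrite /B'; case: ifP.
rewrite gauss_box//= /distribution /pushforward/=.
rewrite (_ : _ @^-1` _ = box B' `*` (B i `*` B j)).
  transitivity (gauss n (box B') * normal_plane R (B i `*` B j))%E; last first.
    apply/esym/(@product_measure1E _ _ _ _ _ (gauss n) (normal_plane R)).
      exact: measurable_boxT.
    by apply: measurableX; exact: mB.
  rewrite [X in (_ * X)%E]product_measure1E; [|exact: mB..].
  rewrite [X in (X * _)%E]gauss_box//.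
  have -> : (\prod_k N01 (B' k) = \prod_(k | (k != i) && (k != j)) N01 (B k))%E.
    rewrite [RHS]big_mkcond/=; apply: eq_bigr => k _.
    rewrite /B' -negb_or; case: (_ || _) => //=.
    exact: (@probability_setT _ _ _ N01).
  rewrite (bigD1 i)//= (bigD1 j) 1?eq_sym//=.
  by rewrite muleA muleC.
apply/seteqP; split=> [z Bz|z [B1 [B2 B3]] k] /=.
  split; last split.
  - move=> k; rewrite /B'; case: ifPn => //; rewrite negb_or => /andP[ki kj].
    by have := Bz k; rewrite ffunE (negbTE ki) (negbTE kj).
  - by have := Bz i; rewrite ffunE eqxx.
  - by have := Bz j; rewrite ffunE eq_sym (negbTE ij) eqxx.
rewrite ffunE; case: eqP => [->//|/eqP ki]; case: eqP => [->//|/eqP kj].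
by have := B1 k; rewrite /B' (negbTE ki) (negbTE kj).
Qed.

Definition givens (c s : R) : 'M[R]_n := \matrix_(k, l)
  (if k == i then c *+ (l == i) - s *+ (l == j)
   else if k == j then s *+ (l == i) + c *+ (l == j) else (k == l)%:R).

Lemma givens_mul c s m (M : 'M[R]_(n, m)) k l : (givens c s *m M) k l =
  if k == i then c * M i l - s * M j l
  else if k == j then s * M i l + c * M j l else M k l.
Proof.
have delta (a : 'I_n) (x : R) : \sum_h (x *+ (h == a)) * M h l = x * M a l.
  rewrite (bigD1 a)//= eqxx mulr1n big1 ?addr0// => h ha.
  by rewrite (negbTE ha) mulr0n mul0r.
rewrite mxE; case: eqP => [->|/eqP ki].
  under eq_bigr do rewrite mxE eqxx mulrBl.
  by rewrite sumrB !delta.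
case: eqP => [->|/eqP kj].
  under eq_bigr do rewrite mxE eq_sym (negbTE ij) eqxx mulrDl.
  by rewrite big_split/= !delta.
under eq_bigr do rewrite mxE (negbTE ki) (negbTE kj) eq_sym.
by rewrite delta mul1r.
Qed.

Lemma givens_orthogonal c s : c ^+ 2 + s ^+ 2 = 1 ->
  givens c s *m (givens c s)^T = 1%:M.
Proof.
move=> cs; have ji : (j == i) = false by rewrite eq_sym; exact: negbTE.
apply/matrixP => k l; rewrite givens_mul !mxE !eqxx ji (negbTE ij).
case: (eqVneq k i) => [->|ki].
  rewrite [i == l]eq_sym; case: (eqVneq l i) => [_|li].
    by rewrite !mulr1n !mulr0n -cs; ring.
  case: (eqVneq l j) => [_|lj]; first by rewrite !mulr1n !mulr0n; ring.
  by rewrite !mulr0n; ring.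
case: (eqVneq k j) => [->|kj].
  rewrite [j == l]eq_sym; case: (eqVneq l i) => [->|li].
    by rewrite (negbTE ij) !mulr1n !mulr0n; ring.
  case: (eqVneq l j) => [_|lj]; first by rewrite !mulr1n !mulr0n -cs; ring.
  by rewrite !mulr0n; ring.
case: (eqVneq l i) => [->|li]; first by rewrite ?(negbTE ki) ?(negbTE kj) !mulr0n subr0.
case: (eqVneq l j) => [->|lj]; first by rewrite ?(negbTE ki) ?(negbTE kj) !mulr0n addr0.
by rewrite eq_sym.
Qed.

Lemma gauss_givens c s (A : set (Rpow R 'I_n)) :
  c ^+ 2 + s ^+ 2 = 1 -> s != 0 -> measurable A ->
  gauss n (lin (givens c s) @^-1` A) = gauss n A.
Proof.
move=> cs s0 mA.
have mlA : measurable (lin (givens c s) @^-1` A).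
  by rewrite -[X in measurable X]setTI; exact: measurable_lin.
rewrite (gauss_replace2 mlA) (gauss_replace2 mA).
apply: eq_integral => z _ /=.
have mrA : measurable (replace2 @^-1` A).
  by rewrite -[X in measurable X]setTI; exact: measurable_replace2.
rewrite -[RHS](normal_plane_rotation cs s0); last exact: measurable_xsection.
congr product_measure1; apply/seteqP.
have E ab : lin (givens c s) (replace2 (z, ab)) = replace2 (z, rotation c s ab).
  have ji : (j == i) = false by rewrite eq_sym; exact: negbTE.
  apply/ffunP => k; rewrite !ffunE givens_mul !mxE !ffunE/= !eqxx ji.
  by case: eqP => // _; case: eqP => // _.
by split=> ab; rewrite /xsection/= !inE/= E.
Qed.

End coordinate_plane.

Section reflection.
Variables (n : nat) (i : 'I_n).

Definition flip : 'M[R]_n := diag_mx (\row_k (-1) ^+ (k == i)).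

Lemma flip_orthogonal : flip *m flip^T = 1%:M.
Proof.
rewrite /flip tr_diag_mx mulmx_diag; apply/matrixP => k l; rewrite !mxE.
by case: (k == i); rewrite /= ?expr1 ?expr0 ?mulrNN mulr1.
Qed.

Lemma gauss_flip (A : set (Rpow R 'I_n)) : measurable A ->
  gauss n (lin flip @^-1` A) = gauss n A.
Proof.
move=> mA; symmetry; move: A mA.
pose l : {mfun Rpow R 'I_n >-> Rpow R 'I_n} :=
  HB.pack (lin flip) (isMeasurableFun.Build _ _ _ _ _ (measurable_lin flip)).
apply: (@eq_probability_box R _ _ (distribution (gauss n) l)) => B mB.
pose B' k : set R := if k == i then -%R @^-1` B k else B k.
have mB' k : measurable (B' k).
  rewrite /B'; case: ifP => // _.
  by rewrite -[X in measurable X]setTI; exact: oppr_measurable.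
rewrite gauss_box//= /distribution /pushforward/=.
rewrite (_ : _ @^-1` _ = box B').
  rewrite gauss_box//; apply: eq_bigr => k _; rewrite /B'; case: ifP => // _.
  by rewrite normalN.
apply/seteqP; split=> z Bz k; have := Bz k; rewrite /B' ffunE mul_diag_mx !mxE;
  by case: ifP => /= _; rewrite ?expr1 ?expr0 ?mulN1r ?mul1r.
Qed.

End reflection.

End standard_gaussian.

(** The same as [gauss_concat] with the first factor itself cut in two, stated
    for the bracketing under which a response is drawn before a parameter. *)
Lemma gauss_concat3 (R : realType) m n q (A : set (Rpow R 'I_(m + n + q))) :
  measurable A -> gauss R (m + n + q) A =
  ((gauss R m \x gauss R n) \x gauss R q)%E
    ((fun z => concat (concat z.1, z.2)) @^-1` A).
Proof.
move=> mA; rewrite gauss_concat//.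
have mcA : measurable (@concat R (m + n) q @^-1` A).
  by rewrite -[X in measurable X]setTI; exact: measurable_concat.
pose f v := gauss R q (xsection (@concat R (m + n) q @^-1` A) v).
rewrite -[LHS]/(\int[gauss R (m + n)]_v f v)%E.
rewrite (@eq_measure_integral _ _ _ setT
  (pushforward (gauss R m \x gauss R n)%E (@concat R m n))).
  by rewrite ge0_integral_pushforward//; exact: measurable_fun_xsection.
by move=> B mB _; exact: gauss_concat.
Qed.

(** * Orthogonal invariance and covariance *)

Section orthogonal_invariance.
Context (R : realType) (n : nat).
Implicit Types (Q O : 'M[R]_n) (k l : 'I_n).

(** This holds for every orthogonal matrix ([orthogonal_gauss_rotation]); the
    predicate is what is stable under the products of elementary rotations by
    which that is proved. *)
Definition gauss_rotation Q := Q *m Q^T = 1%:M /\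
  forall A : set (Rpow R 'I_n), measurable A ->
    gauss R n (lin Q @^-1` A) = gauss R n A.

Lemma preimage_lin_measurable m p (A : 'M[R]_(m, p)) (B : set (Rpow R 'I_m)) :
  measurable B -> measurable (lin A @^-1` B).
Proof.
by move=> mB; rewrite -[X in measurable X]setTI; exact: measurable_lin.
Qed.

Lemma preimage_lin_comp m p q (A : 'M[R]_(m, p)) (B : 'M[R]_(p, q)) C :
  lin B @^-1` (lin A @^-1` C) = lin (A *m B) @^-1` C.
Proof. by apply/seteqP; split=> z /=; rewrite lin_comp. Qed.

Lemma gauss_rotation1 : gauss_rotation 1%:M.
Proof.
split; first by rewrite trmx1 mul1mx.
by move=> A mA; congr (gauss R n _); apply/seteqP; split=> z /=; rewrite lin1.
Qed.

Lemma gauss_rotationM Q O :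
  gauss_rotation Q -> gauss_rotation O -> gauss_rotation (Q *m O).
Proof.
move=> [QQ gQ] [OO gO]; split.
  by rewrite trmx_mul mulmxA -(mulmxA Q) OO mulmx1 QQ.
move=> A mA; rewrite -preimage_lin_comp gO ?gQ//.
exact: preimage_lin_measurable.
Qed.

Lemma gauss_rotationT Q : gauss_rotation Q -> gauss_rotation Q^T.
Proof.
move=> [QQ gQ]; have QQ' := mulmx1C QQ.
split=> [|A mA]; first by rewrite trmxK.
rewrite -gQ; last exact: preimage_lin_measurable.
rewrite preimage_lin_comp QQ'.
by congr (gauss R n _); apply/seteqP; split=> z /=; rewrite lin1.
Qed.

Notation e k := (delta_mx k 0 : 'cV[R]_n).

(** Each nonzero entry of [v] outside of [k] is killed by a rotation in its plane
    with [k], of nonzero sine as the entry is nonzero.  Axes along which [v] has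
    no component are never touched: this last conclusion is what allows to treat
    the columns of a matrix one after the other. *)
Lemma align_axis k (v : 'cV[R]_n) : exists Q,
  [/\ gauss_rotation Q, exists r, Q *m v = r *: e k &
    forall l, l != k -> v l 0 = 0 -> Q *m e l = e l].
Proof.
have [N] := ubnP #|[set i : 'I_n | (i != k) && (v i 0 != 0)]%SET|.
elim: N v => // N ih v; rewrite ltnS => vN.
have [v0|] := eqVneq [set i : 'I_n | (i != k) && (v i 0 != 0)]%SET finset.set0.
  exists 1%:M; split; first exact: gauss_rotation1.
    exists (v k 0); apply/colP => i; rewrite mul1mx !mxE eqxx andbT.
    have [->|ik] := eqVneq i k; first by rewrite mulr1.
    rewrite mulr0; apply/eqP/negPn/negP => vi.
    by have := finset.in_set0 i; rewrite -v0 inE ik vi.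
  by move=> l _ _; rewrite mul1mx.
case/set0Pn => i; rewrite inE => /andP[ik vi].
(* The rotation takes [(v k, v i)] to [(r, 0)]. *)
pose r := Num.sqrt (v k 0 ^+ 2 + v i 0 ^+ 2).
have r2 : r ^+ 2 = v k 0 ^+ 2 + v i 0 ^+ 2 by rewrite sqr_sqrtr// addr_ge0// sqr_ge0.
have r0 : r != 0.
  rewrite -sqrf_eq0 r2 gt_eqF// (lt_le_trans (y := v i 0 ^+ 2))//.
    by rewrite lt0r sqrf_eq0 vi sqr_ge0.
  by rewrite lerDr sqr_ge0.
have ki : k != i by rewrite eq_sym.
pose c := v k 0 / r; pose s := - v i 0 / r.
have cs : c ^+ 2 + s ^+ 2 = 1.
  by rewrite /c /s !expr_div_n sqrrN -mulrDl -r2 divff// sqrf_eq0.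
have s0 : s != 0 by rewrite /s mulf_neq0 ?oppr_eq0 ?invr_eq0.
pose G := givens k i c s.
have gG : gauss_rotation G.
  split; first exact: givens_orthogonal.
  by move=> A mA; exact: gauss_givens.
have vG l : (G *m v) l 0 = if l == k then r else if l == i then 0 else v l 0.
  rewrite givens_mul//; case: eqP => // _.
    rewrite (_ : _ - _ = (v k 0 ^+ 2 + v i 0 ^+ 2) / r); last by rewrite /c /s; ring.
    by rewrite -r2 expr2 mulfK.
  by case: eqP => // _; rewrite /c /s; ring.
have [|Q [gQ [q Qv] Qe]] := ih (G *m v).
  apply: leq_trans vN; apply: proper_card; apply/properP; split.
    apply/fintype.subsetP => l; rewrite !inE vG => /andP[lk]; rewrite lk (negbTE lk).
    by rewrite (fun_if (fun x => x != 0)) eqxx; case: (l == i).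
  by exists i; rewrite !inE ?ik ?vi// vG eqxx (negbTE ik) eqxx.
exists (Q *m G); split; first exact: gauss_rotationM.
  by exists q; rewrite -mulmxA.
move=> l lk vl.
have li : l != i by apply: contra_neq vi => <-.
have GE : G *m e l = e l.
  apply/colP => h; rewrite givens_mul// !mxE !eqxx !andbT.
  rewrite [k == l]eq_sym (negbTE lk) [i == l]eq_sym (negbTE li) !mulr0 subr0 addr0.
  case: (eqVneq h k) => [->|_]; first by rewrite eq_sym (negbTE lk).
  by case: (eqVneq h i) => [->|_]; first by rewrite eq_sym (negbTE li).
rewrite -mulmxA GE Qe// vG (negbTE lk).
by rewrite (negbTE li).
Qed.

(** After alignment the unit vector is plus or minus the axis, and a change of
    sign corrects the second case. *)
Lemma align_unit_vector k (v : 'cV[R]_n) : v^T *m v = 1%:M -> exists Q,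
  [/\ gauss_rotation Q, Q *m v = e k &
    forall l, l != k -> v l 0 = 0 -> Q *m e l = e l].
Proof.
move=> v1; have [Q [gQ [r Qv] Qe]] := align_axis k v.
have ee : (e k)^T *m e k = 1%:M.
  by rewrite trmx_delta mul_delta_mx; apply/matrixP => a b; rewrite !ord1 !mxE.
have : r ^+ 2 = 1.
  have : (Q *m v)^T *m (Q *m v) = 1%:M.
    by rewrite trmx_mul -mulmxA (mulmxA Q^T) (mulmx1C gQ.1) mul1mx.
  rewrite Qv -scalemxAr [X in X *m _]linearZ/= -scalemxAl ee scalerA => /matrixP/(_ 0 0).
  by rewrite !mxE mulr1 expr2.
move/eqP; rewrite sqrf_eq1 => /orP[/eqP r1|/eqP r1].
  by exists Q; split => //; rewrite Qv r1 scale1r.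
have flipE l : flip R k *m e l = (-1) ^+ (l == k) *: e l.
  apply/colP => h; rewrite mul_diag_mx !mxE eqxx andbT.
  by case: (eqVneq h l) => [->|]//; rewrite !mulr0.
exists (flip R k *m Q); split.
- apply: gauss_rotationM => //; split; first exact: flip_orthogonal.
  by move=> A; exact: gauss_flip.
- by rewrite -mulmxA Qv -scalemxAr flipE eqxx expr1 r1 scalerA mulrNN mulr1 scale1r.
- by move=> l lk vl; rewrite -mulmxA Qe// flipE (negbTE lk) expr0 scale1r.
Qed.

(** Induction on the number of basis vectors that [O] moves.  If [O] moves the
    [k]th one, aligning its image with the [k]th axis keeps the fixed vectors
    fixed: they are orthogonal to that image, as [O] preserves orthogonality. *)
Lemma orthogonal_gauss_rotation O : O *m O^T = 1%:M -> gauss_rotation O.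
Proof.
have [N] := ubnP #|[set l : 'I_n | O *m e l != e l]%SET|.
elim: N O => // N ih O; rewrite ltnS => ON OO.
have [fix0|] := eqVneq [set l : 'I_n | O *m e l != e l]%SET finset.set0.
  have fixO l : O *m e l = e l.
    apply/eqP/negPn/negP => Ol.
    by have := finset.in_set0 l; rewrite -fix0 inE Ol.
  have -> : O = 1%:M; last exact: gauss_rotation1.
  apply/matrixP => a b; have := fixO b; rewrite -colE => /colP/(_ a).
  by rewrite !mxE eqxx andbT.
case/set0Pn => k; rewrite inE => Ok.
have OO' := mulmx1C OO.
have dot_e a b : (e a)^T *m e b = (a == b)%:R%:M.
  by rewrite trmx_delta mul_delta_mx_cond; apply/matrixP => i j; rewrite !ord1 mulmxnE !mxE/=.
have dotO (v w : 'cV[R]_n) : (O *m v)^T *m (O *m w) = v^T *m w.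
  by rewrite trmx_mul -mulmxA (mulmxA O^T) OO' mul1mx.
have [|Q [gQ Qv Qe]] := @align_unit_vector k (O *m e k).
  by rewrite dotO dot_e eqxx.
have fixl l : O *m e l = e l -> Q *m (O *m e l) = e l.
  move=> Ol; have lk : l != k by apply: contra_neq Ok => <-.
  rewrite Ol Qe//.
  have : (e l)^T *m (O *m e k) = 0.
    rewrite -{1}Ol dotO dot_e (negbTE lk).
    by apply/matrixP => a b; rewrite !mxE mul0rn.
  by rewrite trmx_delta -rowE => /matrixP/(_ 0 0); rewrite !mxE.
rewrite (_ : O = Q^T *m (Q *m O)); last by rewrite mulmxA (mulmx1C gQ.1) mul1mx.
apply: gauss_rotationM; first exact: gauss_rotationT.
apply: ih; last by rewrite trmx_mul mulmxA -(mulmxA Q) OO mulmx1 gQ.1.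
apply: leq_trans ON; apply: proper_card; apply/properP; split.
  apply/fintype.subsetP => l; rewrite !inE; apply: contra => /eqP Ol.
  by rewrite -mulmxA fixl.
by exists k; rewrite !inE ?Ok// -mulmxA Qv eqxx.
Qed.

End orthogonal_invariance.

Section gauss_covariance.
Context (R : realType).

Lemma gauss_lin_row_mx0 m n p (A : 'M[R]_(m, n)) (C : set (Rpow R 'I_m)) :
  measurable C ->
  gauss R (n + p) (lin (row_mx A 0) @^-1` C) = gauss R n (lin A @^-1` C).
Proof.
move=> mC; rewrite gauss_concat; last exact: preimage_lin_measurable.
have concatE z : lin (row_mx A 0) (concat z) = lin A z.1 :> Rpow R 'I_m.
  by rewrite /lin /concat of_colK mul_row_col mul0mx addr0.
rewrite (_ : _ @^-1` _ = (lin A @^-1` C) `*` [set: Rpow R 'I_p]).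
  rewrite product_measure1E//; last exact: preimage_lin_measurable.
  by rewrite [X in (_ * X)%E](@probability_setT _ _ _ (gauss R p)) mule1.
by apply/seteqP; split=> [z|z []] /=; rewrite concatE.
Qed.

Lemma gauss_lin_row_0mx m n p (A : 'M[R]_(m, p)) (C : set (Rpow R 'I_m)) :
  measurable C ->
  gauss R (n + p) (lin (row_mx 0 A) @^-1` C) = gauss R p (lin A @^-1` C).
Proof.
move=> mC; rewrite gauss_concat; last exact: preimage_lin_measurable.
have concatE z : lin (row_mx 0 A) (concat z) = lin A z.2 :> Rpow R 'I_m.
  by rewrite /lin /concat of_colK mul_row_col mul0mx add0r.
rewrite (_ : _ @^-1` _ = [set: Rpow R 'I_n] `*` (lin A @^-1` C)).
  rewrite product_measure1E//; last exact: preimage_lin_measurable.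
  by rewrite [X in (X * _)%E](@probability_setT _ _ _ (gauss R n)) mul1e.
by apply/seteqP; split=> [z|z []] /=; rewrite concatE.
Qed.

(** With [K] the common covariance and [U = A^T K^-1 B], we have [A U = B] and
    [A U U^T = A], and [U] is a partial isometry.  The matrix [D] below is then
    orthogonal and maps the row [(A, 0)] to [(0, B)], so the standard Gaussian
    vector of dimension [n + p] has the same image under both rows. *)
Lemma gauss_cov_eq m n p (A : 'M[R]_(m, n)) (B : 'M[R]_(m, p))
    (C : set (Rpow R 'I_m)) :
  A *m A^T = B *m B^T -> A *m A^T \in unitmx -> measurable C ->
  gauss R n (lin A @^-1` C) = gauss R p (lin B @^-1` C).
Proof.
move=> AB; set K := A *m A^T => Ku mC.
have KT : K^T = K by rewrite /K trmx_mul trmxK.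
have KiT : (invmx K)^T = invmx K by rewrite trmx_inv KT.
pose U := A^T *m invmx K *m B.
have UT : U^T = B^T *m invmx K *m A by rewrite /U !trmx_mul trmxK KiT mulmxA.
have AU : A *m U = B by rewrite /U !mulmxA mulmxV// mul1mx.
have AUU : A *m U *m U^T = A.
  by rewrite AU UT !mulmxA -AB mulmxV// mul1mx.
have UUU : U *m U^T *m U = U.
  have UA : U *m U^T *m A^T = A^T.
    by have := congr1 trmx AUU; rewrite trmx_mul trmxK trmx_mul mulmxA.
  have -> : U *m U^T *m U = U *m U^T *m A^T *m invmx K *m B by rewrite {3}/U !mulmxA.
  by rewrite UA.
move: U AU AUU UUU {UT} => U AU AUU UUU.
have UUU' : U^T *m U *m U^T = U^T.
  by have := congr1 trmx UUU; rewrite !trmx_mul trmxK mulmxA.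
pose D := block_mx (1%:M - U *m U^T) U (- U^T) (1%:M - U^T *m U).
have DD : D *m D^T = 1%:M.
  rewrite /D tr_block_mx !linearB/= !trmx_mul !trmx1 !linearN/= !trmxK mulmx_block.
  rewrite [RHS]scalar_mx_block; congr block_mx.
  - rewrite mulmxBl mul1mx mulmxBr mulmx1 !mulmxA UUU.
    by rewrite subrr subr0 subrK.
  - rewrite mulmxN mulmxBl mul1mx mulmxBr mulmx1 !mulmxA UUU.
    by rewrite subrr oppr0 addr0.
  - rewrite mulNmx mulmxBr mulmx1 mulmxBl mul1mx !mulmxA UUU'.
    by rewrite subrr oppr0 addr0.
  - rewrite mulNmx mulmxN opprK mulmxBl mul1mx mulmxBr mulmx1 !mulmxA UUU'.
    by rewrite subrr subr0 addrC subrK.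
have AD : row_mx A 0 *m D = row_mx 0 B.
  by rewrite mul_row_block !mul0mx !addr0 AU mulmxBr mulmx1 mulmxA AUU subrr.
have [_ gD] := orthogonal_gauss_rotation DD.
rewrite -(gauss_lin_row_mx0 p)// -gD; last exact: preimage_lin_measurable.
by rewrite preimage_lin_comp AD gauss_lin_row_0mx.
Qed.

End gauss_covariance.

(** * Norms are determined by Gaussian laws *)

Section normal_width.
Context (R : realType).
Notation mu := (@lebesgue_measure R).
Notation N01 := (normal_prob 0 1 : probability (measurableTypeR R) R).

Lemma normal_prob_itv_gt0 (a b : R) : a < b -> (0 < N01 `]a, b[%classic)%E.
Proof.
move=> ab; rewrite lt0e measure_ge0 andbT; apply/eqP => N0.
have mphi : measurable_fun `]a, b[%classic
    (fun x => (normal_pdf (0 : R) 1 x)%:E).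
  apply: measurable_funTS; apply/measurable_EFinP.
  exact: measurable_normal_pdf.
have : (\int[mu]_(x in `]a, b[) `|(normal_pdf (0 : R) 1 x)%:E| = 0)%E.
  rewrite -[RHS]N0 /= /normal_prob; apply: eq_integral => x _.
  by rewrite ger0_norm// ?normal_pdf_ge0.
move/(ae_eq_integral_abs mu (measurable_itv _) mphi) => [N [mN muN sub]].
have abN : `]a, b[%classic `<=` N.
  apply: subset_trans sub => x xab /= /(_ xab)/eqP.
  rewrite eqe normal_pdfE ?oner_eq0//; apply/negP.
  by rewrite gt_eqF// mulr_gt0 ?expR_gt0// normal_peak_gt0 ?oner_eq0.
have : (mu `]a, b[%classic <= 0)%E.
  by rewrite -muN; apply: le_measure; rewrite ?inE.
by rewrite lebesgue_measure_itv/= lte_fin ab -EFinB lee_fin leNgt subr_gt0 ab.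
Qed.

(** The scales [r < s] are told apart by a bounded interval on which
    [r x <= 1 < s x] and which has positive mass. *)
Lemma normal_prob_width (r s : R) : 0 <= r -> r < s ->
  N01 [set x | r * x <= 1] <> N01 [set x | s * x <= 1].
Proof.
move=> r0 rs; have s0 : 0 < s by exact: le_lt_trans rs.
have rs0 : 0 < r + s by exact: ltr_wpDl.
(* [b] is finite even for [r = 0], and [r b <= 1] as [r <= s]. *)
pose a := s^-1; pose b := 2 / (r + s).
have ab : a < b by rewrite /a /b ltr_pdivlMr// mulrC ltr_pdivrMr//; lra.
have mle (t : R) : measurable [set x : R | t * x <= 1].
  rewrite -[X in measurable X]/[set x | [set y : R | y <= 1] (t * x)].
  by apply: measurable_preimage_mull; rewrite -set_itvNyc; exact: measurable_itv.
move=> E; have : (N01 ([set x | s * x <= 1]%R `|` `]a, b[%classic) <=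
    N01 [set x | s * x <= 1]%R)%E.
  rewrite -[leRHS]E; apply: le_measure.
  - by rewrite inE; apply: measurableU; [exact: mle|exact: measurable_itv].
  - by rewrite inE; exact: mle.
  move=> x [/= sx|/=].
    case: (leP x 0) => x0; last by rewrite (le_trans _ sx)// ler_pM2r// ltW.
    by rewrite (le_trans (mulr_ge0_le0 r0 x0)).
  rewrite in_itv/= => /andP[_ xb].
  apply: (@le_trans _ _ (r * b)); first by rewrite ler_wpM2l// ltW.
  by rewrite /b mulrA ler_pdivrMr// mul1r; lra.
rewrite measureU; [|exact: mle|exact: measurable_itv|]; last first.
  apply/seteqP; split=> x //= [sx]; rewrite in_itv/= => /andP[ax _].
  by move: sx; rewrite leNgt mulrC -ltr_pdivrMr// div1r ax.
rewrite -[leRHS]adde0 leeD2lE; last by apply: fin_num_measure; exact: mle.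
by rewrite leNgt normal_prob_itv_gt0.
Qed.

Lemma gauss_scale_law (r : R) (B : set R) : measurable B ->
  gauss R 1 [set z | B (r * (z : {ffun _ -> R}) 0)] = N01 [set x | B (r * x)].
Proof.
move=> mB.
have mrB := measurable_preimage_mull r mB.
rewrite (_ : [set z | _] = box (fun=> [set x | B (r * x)])).
  by rewrite gauss_box// big_ord1.
by apply/seteqP; split=> z; [move=> Bz i; rewrite ord1|move/(_ 0)].
Qed.

(** The row [a] and the number [|a|] have the same covariance. *)
Lemma gauss_row_law p (a : 'rV[R]_p) (B : set R) : measurable B ->
  gauss R p [set z | B ((a *m to_col z) 0 0)] =
  N01 [set x | B (Num.sqrt ((a *m a^T) 0 0) * x)].
Proof.
move=> mB; set q := (a *m a^T) 0 0.
have q0 : 0 <= q.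
  by rewrite /q mxE; apply: sumr_ge0 => i _; rewrite mxE -expr2 sqr_ge0.
have qE : a *m a^T = q%:M by rewrite [LHS]mx11_scalar.
(* A zero row has no invertible covariance, but then both laws are Dirac at 0. *)
have [qz|qn0] := eqVneq q 0.
  have a0 : a = 0.
    apply/rowP => i; rewrite mxE; apply/eqP; rewrite -sqrf_eq0; apply/eqP.
    have /psumr_eq0P : \sum_j a 0 j ^+ 2 = 0.
      by rewrite -[RHS]qz /q mxE; apply: eq_bigr => j _; rewrite mxE expr2.
    by apply => // j _; rewrite sqr_ge0.
  rewrite qz sqrtr0 a0.
  under eq_set do rewrite mul0mx mxE.
  under [in RHS]eq_set do rewrite mul0r.
  have [B0|B0] := pselect (B 0).
    have BT (T : Type) : [set _ : T | B 0] = setT by apply/seteqP; split.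
    by rewrite !BT !probability_setT.
  have BT (T : Type) : [set _ : T | B 0] = set0 by apply/seteqP; split.
  by rewrite !BT !measure0.
rewrite -gauss_scale_law//.
pose C : set (Rpow R 'I_1) := [set y | B ((y : {ffun _ -> R}) 0)].
have mC : measurable C.
  rewrite [X in measurable X](_ : _ =
    setT `&` (fun y : Rpow R 'I_1 => (y : {ffun _ -> R}) 0) @^-1` B).
    exact: measurable_sample.
  by rewrite setTI.
have /(_ C) := @gauss_cov_eq R 1 p 1 a (Num.sqrt q)%:M.
rewrite qE tr_scalar_mx -scalar_mxM -expr2 sqr_sqrtr// => /(_ erefl).
rewrite unitmxE det_scalar expr1 unitfE qn0 => /(_ isT mC) E.
rewrite (_ : [set z | _] = lin a @^-1` C); last first.
  by apply/seteqP; split=> z; rewrite /C /lin/= ffunE.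
rewrite E; congr (gauss R 1 _).
by apply/seteqP; split=> z; rewrite /C /lin/= ffunE mul_scalar_mx !mxE.
Qed.

Lemma gauss_row_law_inj p q (a : 'rV[R]_p) (b : 'rV[R]_q) :
  (forall B, measurable B ->
    gauss R p [set z | B ((a *m to_col z) 0 0)] =
    gauss R q [set z | B ((b *m to_col z) 0 0)]) ->
  (a *m a^T) 0 0 = (b *m b^T) 0 0.
Proof.
have ge0 m (c : 'rV[R]_m) : 0 <= (c *m c^T) 0 0.
  by rewrite mxE; apply: sumr_ge0 => i _; rewrite mxE -expr2 sqr_ge0.
move=> ab; have mI : measurable [set x : R | x <= 1].
  by rewrite -set_itvNyc; exact: measurable_itv.
have sqrt_inj : Num.sqrt ((a *m a^T) 0 0) = Num.sqrt ((b *m b^T) 0 0).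
  have := ab _ mI; rewrite !gauss_row_law//.
  move: (Num.sqrt _) (sqrtr_ge0 ((a *m a^T) 0 0)) => r r0.
  move: (Num.sqrt _) (sqrtr_ge0 ((b *m b^T) 0 0)) => s s0 rs.
  case: (ltgtP r s) => // lt_rs; first by case: (normal_prob_width r0 lt_rs).
  by case: (normal_prob_width s0 lt_rs).
by rewrite -[LHS]sqr_sqrtr// sqrt_inj sqr_sqrtr.
Qed.

End normal_width.

(** * Coherence of the ridge prior *)

Section dual_coordinates.
Context (R : realType) (V : vectType R).
Notation n := (\dim {: V}).
Implicit Types e : n.-tuple V.

Definition dual_of_col e (c : 'cV[R]_n) : dual_space V :=
  dual_of_coords e (fun i => c i 0).

Lemma dual_of_colE e c v :
  (dual_of_col e c : 'Hom(V, R^o)) v = \sum_i c i 0 * coord e i v :> R.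
Proof. exact: dual_of_coordsE. Qed.

Lemma measurable_dual_of_col d (X : measurableType d) e (f : X -> 'cV[R]_n) :
  (forall i, measurable_fun setT (fun x => f x i 0)) ->
  measurable_fun setT (fun x => dual_of_col e (f x)).
Proof. by move=> mf; exact: measurable_dual_of_coords. Qed.

Lemma dual_normal_diracE e (m : 'cV[R]_n) (L : 'M[R]_n) (s : Rpos R)
    (S : set (dual_space V * Rpos R)) : measurable S ->
  (dual_normal e m L \x \d_s)%E S =
  gauss R n [set z | S (dual_of_col e (m + L *m to_col z), s)].
Proof.
move=> mS.
have mSs : measurable ((fun b : dual_space V => (b, s)) @^-1` S).
  rewrite -[X in measurable X]setTI; apply: measurable_fun_pair => //.
rewrite /product_measure1.
rewrite (eq_integral (fun b => (\1_((fun b : dual_space V => (b, s)) @^-1` S) b)%:E)).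
  rewrite integral_indic// setIT.
  rewrite -[LHS]/(gauss R n ((dual_of_sample e \o affine m L) @^-1`
    ((fun b : dual_space V => (b, s)) @^-1` S))).
  congr (gauss R n _); apply/seteqP.
  have E z : dual_of_sample e (affine m L z) = dual_of_col e (m + L *m to_col z).
    rewrite /dual_of_sample /dual_of_col; congr dual_of_coords.
    apply/funext => i; rewrite ffunE !mxE; congr (_ + _).
    by apply: eq_bigr => j _; rewrite mxE.
  by split=> z /=; rewrite E.
move=> b _ /=; rewrite diracE indicE xsectionE; congr (nat_of_bool _)%:R%:E.
Qed.

Variable ip : {dot V for idfun}.

Lemma coord_ip e v i : orthonormal_basis ip e -> coord e i v = ip v e`_i.
Proof.
move=> [eb eo]; rewrite {2}(coord_basis eb (memvf v)) linear_sumlz.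
rewrite (bigD1 i)//= linearZl_LR/= eo eqxx mulr1 big1 ?addr0// => j ji.
by rewrite linearZl_LR/= eo (negbTE ji) mulr0.
Qed.

Lemma ip_coord e u v : orthonormal_basis ip e ->
  ip u v = \sum_i coord e i u * coord e i v.
Proof.
move=> eo; rewrite {1}(coord_basis eo.1 (memvf u)) linear_sumlz.
apply: eq_bigr => i _; rewrite linearZl_LR/=; congr (_ * _).
by rewrite (coord_ip _ _ eo) ipC.
Qed.

End dual_coordinates.

Section pullback.
Context (R : realType) (V V' : vectType R).
Variables (ip : {dot V for idfun}) (ip' : {dot V' for idfun}).
Variables (e : (\dim {: V}).-tuple V) (e' : (\dim {: V'}).-tuple V').
Hypotheses (eo : orthonormal_basis ip e) (eo' : orthonormal_basis ip' e').
Variable psi : 'Hom(V, V').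

(** The transpose of the matrix of [psi]: it acts on coordinates of functionals. *)
Definition coord_mx : 'M[R]_(\dim {: V}, \dim {: V'}) :=
  \matrix_(i, j) coord e' j (psi e`_i).

Lemma dual_of_col_comp c :
  ((dual_of_col e' c : 'Hom(V', R^o)) \o psi)%VF = dual_of_col e (coord_mx *m c).
Proof.
rewrite -[LHS](dual_coordsK _ eo.1); congr dual_of_coords.
apply/funext => i; rewrite comp_lfunE dual_of_colE mxE.
by apply: eq_bigr => j _; rewrite mxE mulrC.
Qed.

(** Only the rows are orthonormal: [psi] need not be surjective. *)
Lemma coord_mx_isometry : isometry ip' ip psi -> coord_mx *m coord_mx^T = 1%:M.
Proof.
move=> iso_psi; apply/matrixP => i j; rewrite !mxE -eo.2.
transitivity (ip' (psi e`_i) (psi e`_j)); last exact: iso_psi.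
by rewrite (ip_coord _ _ eo'); apply: eq_bigr => k _; rewrite !mxE.
Qed.

End pullback.

Section ridge_prior.
Context (R : realType).
Variables (sigma2 tau2 : R) (sigma2_gt0 : 0 < sigma2) (tau2_gt0 : 0 < tau2).
Variable ip : inner_products R.

Let pi := ridge_prior ip tau2 sigma2_gt0.
Let basis (w : subspace_obj R) := orthonormal_choice (ip w).

Lemma orthonormal_choiceP w : orthonormal_basis (ip w) (basis w).
Proof. by rewrite /basis /orthonormal_choice; case: cid. Qed.

Lemma ridge_priorE w (S : set (gaussian_parameters R w)) : measurable S ->
  pi w S = gauss R _ [set z | S (dual_of_col (basis w) (Num.sqrt tau2 *: to_col z),
                              known_variance sigma2_gt0)].
Proof.
move=> mS; have := dual_normal_diracE (basis w) 0 (Num.sqrt tau2)%:M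
  (known_variance sigma2_gt0) mS.
move=> E; rewrite [LHS]E; congr (gauss R _ _).
by apply/seteqP; split=> z /=; rewrite add0r mul_scalar_mx.
Qed.

(** In orthonormal coordinates the pullback is a matrix [Q] with [Q Q^T = 1],
    which is also the covariance of the identity. *)
Lemma ridge_prior_isometry (w w' : subspace_category R) (psi : cov_hom w w') :
  isometry (ip w') (ip w) (cov_fun psi) -> coherent_at pi psi.
Proof.
move=> iso_psi S mS.
have mpS : measurable (par_map (gaussian_parameters R) psi @^-1` S).
  by rewrite -[X in measurable X]setTI; exact: measurable_funP.
apply: (etrans (ridge_priorE mS)); apply: (etrans _ (esym (ridge_priorE mpS))).
pose Q := coord_mx (basis w) (basis w') psi.
have QQ : Q *m Q^T = 1%:M.
  exact: (coord_mx_isometry (orthonormal_choiceP w) (orthonormal_choiceP w')).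
pose C : set (Rpow R 'I_(\dim {: subspace_el w})) :=
  [set z | S (dual_of_col (basis w) (Num.sqrt tau2 *: to_col z),
             known_variance sigma2_gt0)].
have mC : measurable C.
  rewrite -[X in measurable X]setTI.
  apply: (_ : measurable_fun setT (fun z : Rpow R 'I_(\dim {: subspace_el w}) =>
    (dual_of_col (basis w) (Num.sqrt tau2 *: to_col z),
     known_variance sigma2_gt0))) => //.
  apply: measurable_fun_pair => //; apply: measurable_dual_of_col => i.
  rewrite (_ : (fun _ => _) = fun z => Num.sqrt tau2 * to_col z i 0).
    by apply: measurable_funM => //; exact: measurable_to_col.
  by apply/funext => z; rewrite mxE.
have /(_ C) := @gauss_cov_eq R _ _ _ 1%:M Q.
rewrite trmx1 mul1mx QQ => /(_ erefl (unitmx1 _ _) mC).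
rewrite (_ : lin 1%:M @^-1` C = C); last by apply/seteqP; split=> z /=; rewrite lin1.
move=> ->; congr (gauss R _ _); apply/seteqP.
have E z : par_map (gaussian_parameters R) psi
    (dual_of_col (basis w') (Num.sqrt tau2 *: to_col z), known_variance sigma2_gt0) =
    (dual_of_col (basis w) (Num.sqrt tau2 *: to_col (lin Q z)), known_variance sigma2_gt0).
  congr pair; rewrite /lin of_colK scalemxAr.
  exact: (dual_of_col_comp _ (orthonormal_choiceP w)).
by split=> z; rewrite /C/= -E.
Qed.

Lemma measurable_parameter_eval w (v : subspace_el w) (B : set R) : measurable B ->
  measurable ([set t | B ((t.1 : 'Hom(_, R^o)) v)] : set (gaussian_parameters R w)).
Proof.
move=> mB; rewrite [X in measurable X](_ : _ = setT `&`
  ((fun b : dual_space (subspace_el w) => (b : 'Hom(_, R^o)) v : R) \o fst) @^-1` B).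
  exact: (measurableT_comp (measurable_dual v) measurable_fst).
by rewrite setTI.
Qed.

Lemma ridge_prior_eval w (v : subspace_el w) (B : set R) : measurable B ->
  pi w [set t | B ((t.1 : 'Hom(_, R^o)) v)] =
  gauss R _ [set z | B (Num.sqrt tau2 *
    ((\row_i coord (basis w) i v) *m to_col z) 0 0)].
Proof.
move=> mB; rewrite ridge_priorE; last exact: measurable_parameter_eval.
congr (gauss R _ _); apply/seteqP.
have E z : (dual_of_col (basis w) (Num.sqrt tau2 *: to_col z) : 'Hom(_, R^o)) v =
    Num.sqrt tau2 * ((\row_i coord (basis w) i v) *m to_col z) 0 0.
  rewrite dual_of_colE mxE mulr_sumr; apply: eq_bigr => i _.
  by rewrite !mxE; ring.
by split=> z /=; rewrite E.
Qed.

(** Evaluation at [v] is a linear form in the standard Gaussian vector with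
    covariance [tau2 |v|^2], and coherence equates its law with that of the
    evaluation at [psi v].  Hence [psi] preserves norms, and inner products by
    polarization. *)
Lemma ridge_prior_coherent_isometry (w w' : subspace_category R) (psi : cov_hom w w') :
  coherent_at pi psi -> isometry (ip w') (ip w) (cov_fun psi).
Proof.
move=> cpsi; have t0 : Num.sqrt tau2 != 0 by rewrite gt_eqF// sqrtr_gt0.
pose f : 'Hom(subspace_el w, subspace_el w') := psi.
have norm v : ip w' (f v) (f v) = ip w v v.
  rewrite (ip_coord _ _ (orthonormal_choiceP w)).
  rewrite (ip_coord _ _ (orthonormal_choiceP w')).
  have := @gauss_row_law_inj R _ _ (\row_i coord (basis w') i (f v))
    (\row_i coord (basis w) i v).
  rewrite !mxE.
  under eq_bigr do rewrite !mxE.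
  under [in RHS]eq_bigr do rewrite !mxE.
  apply => B mB.
  (* Undoes the scaling of the prior. *)
  pose B' : set R := [set x | B ((Num.sqrt tau2)^-1 * x)].
  have mB' : measurable B'.
    exact: measurable_preimage_mull.
  have mev := measurable_parameter_eval v mB'.
  have E1 := ridge_prior_eval v mB'.
  have := ridge_prior_eval (f v) mB'.
  rewrite (_ : [set t | B' _] = par_map (gaussian_parameters R) psi @^-1`
      [set t | B' ((t.1 : 'Hom(_, R^o)) v)]); last first.
    by apply/seteqP; split=> t /=; rewrite comp_lfunE.
  move=> E2; have := etrans (esym E2) (etrans (esym (cpsi _ mev)) E1).
  rewrite /B'; under eq_set do rewrite /= mulKf//.
  by under [in RHS]eq_set do rewrite /= mulKf//.
have polarize (V : vectType R) (i : {dot V for idfun}) x y :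
    i (x + y) (x + y) = i x x + i y y + i x y *+ 2.
  by rewrite linearDl/= !linearD/= (ipC i y x) mulr2n; ring.
move=> u v; have := norm (u + v); rewrite linearD/= !polarize !norm.
by move/addrI => /eqP; rewrite eqrMn2r// => /eqP.
Qed.

End ridge_prior.

Section ridge_prior_coherence.
Context (R : realType).
Variables (sigma2 tau2 : R) (sigma2_gt0 : 0 < sigma2) (tau2_gt0 : 0 < tau2).
Variable ip : inner_products R.

Let pi := ridge_prior ip tau2 sigma2_gt0.

(** As the universe is a disjoint union of coordinate spaces, an insertion stays
    in one of them and is an inclusion of subspaces there. *)
Lemma insertion_isometry (w w' : subspace_category R) (f : cov_hom w w') :
  restricts_along_insertions ip -> insertion f ->
  isometry (ip w') (ip w) (cov_fun f).
Proof.
move: w w' f => [p U] [q V] f res [femb _].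
have pq : q = p by exact: (congr1 tag (femb 0)).
move: V f femb; rewrite {}pq => V f femb.
have fval x : vsval (f x : subvs_of V) = vsval (x : subvs_of U).
  exact: (eq_from_Tagged (femb x)).
have UV : (U <= V)%VS.
  by apply/subvP => x xU; rewrite -(vsprojK xU) -fval subvsP.
by move=> u v; apply/esym/res => //; rewrite fval.
Qed.

Lemma ridge_prior_coherent_over_red : restricts_along_insertions ip ->
  coherent_over pi (@Omega_red (subspace_category R)).
Proof.
move=> res; apply: coherent_over_generated => w w' f ins.
exact/ridge_prior_isometry/insertion_isometry.
Qed.

Lemma ridge_prior_not_coherent_over_inj :
  ~ coherent_over pi (@Omega_inj (subspace_category R)).
Proof.
move=> coh; pose w : subspace_category R := existT _ 1%N {:'rV[R]_1}%VS.
pose A : cov_hom w w := (2 *: \1)%VF; pose B : cov_hom w w := (2^-1 *: \1)%VF.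
have isoA : iso A.
  have two : (2 : R) != 0 by rewrite pnatr_eq0.
  exists B; split; apply/lfunP => x; rewrite comp_lfunE !scale_lfunE !id_lfunE scalerA.
    by rewrite mulVf// scale1r.
  by rewrite mulfV// scale1r.
have /(ridge_prior_coherent_isometry tau2_gt0) isomA : coherent_at pi A.
  by apply: coh; apply: gen_base; right.
pose v : subspace_el w := vsproj {:'rV[R]_1}%VS (const_mx 1).
have v0 : v != 0.
  apply/eqP => /(congr1 vsval); rewrite vsprojK ?memvf// linear0.
  by move=> /matrixP/(_ 0 0)/eqP; rewrite !mxE oner_eq0.
have := isomA v v.
rewrite /A/= scale_lfunE id_lfunE linearZl_LR/= linearZ/=.
have vv : 0 < ip w v v := neq0_dnorm_gt0 _ v0.
move=> E; have : (2 * (2 * ip w v v)) = ip w v v := E.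
lra.
Qed.

End ridge_prior_coherence.

(** * Bayesian inversion from joint laws *)

Section laws.
Context (R : realType).

Lemma measurable_law d1 d2 d3 (X : measurableType d1) (W : measurableType d2)
    (Y : measurableType d3) (Q : probability W R) (r : X * W -> Y) (T : set Y) :
  measurable_fun setT r -> measurable T ->
  measurable_fun setT (fun x => Q ((fun w => r (x, w)) @^-1` T)).
Proof.
move=> mr mT; have mrT : measurable (r @^-1` T).
  by rewrite -[X in measurable X]setTI; exact: mr.
rewrite (_ : (fun _ => _) = Q \o xsection (r @^-1` T)).
  exact: measurable_fun_xsection.
by apply/funext => x /=; rewrite xsectionE.
Qed.

(** If [pi] is the law of [th z] and [k x] that of [r (x, w)], then the integral
    is the probability of an event on independent draws of [z] and [w]. *)
Lemma integral_law d1 d2 d3 d4 (Z : measurableType d1) (W : measurableType d2)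
    (X : measurableType d3) (Y : measurableType d4)
    (P : probability Z R) (Q : probability W R)
    (th : Z -> X) (r : X * W -> Y)
    (pi : {measure set X -> \bar R}) (k : X -> {measure set Y -> \bar R}) :
  measurable_fun setT th -> measurable_fun setT r ->
  (forall S, measurable S -> pi S = P (th @^-1` S)) ->
  (forall x T, measurable T -> k x T = Q ((fun w => r (x, w)) @^-1` T)) ->
  forall S T, measurable S -> measurable T ->
  (\int[pi]_(x in S) k x T =
   (P \x Q) [set z | S (th z.1) /\ T (r (th z.1, z.2))])%E.
Proof.
move=> mth mr piE kE S T mS mT.
under eq_integral do rewrite kE//.
rewrite (@eq_measure_integral _ _ _ S (pushforward P th)); last first.
  by move=> A mA _; rewrite piE.
rewrite ge0_integral_pushforward//; last first.
  by apply: measurable_funTS; exact: measurable_law.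
rewrite integral_mkcond; apply: eq_integral => z _ /=.
rewrite patchE; case: ifPn => [/set_mem Sz|/negP Sz].
  by rewrite xsectionE; congr (Q _); apply/seteqP; split=> w; [split|case].
rewrite (_ : xsection _ z = set0) ?measure0//.
rewrite xsectionE; apply/seteqP; split=> w // -[Sz' _].
by apply: Sz; exact/mem_set.
Qed.

Lemma marginalE d1 d2 (X : measurableType d1) (Y : measurableType d2)
    (pi : probability X R) (k : R.-pker X ~> Y) T :
  marginal pi k T = (\int[pi]_x k x T)%E.
Proof. by []. Qed.

(** Both sides of the inversion formula are probabilities: on the left [z] draws
    the parameter and [w] the response, on the right these two draw the response
    and an independent [w'] draws the parameter from it. *)
Lemma bayesian_inversion_of_joint d1 d2 d3 d4 d5
    (Z : measurableType d1) (W : measurableType d2) (W' : measurableType d3)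
    (X : measurableType d4) (Y : measurableType d5)
    (P : probability Z R) (Q : probability W R) (Q' : probability W' R)
    (th : Z -> X) (r : X * W -> Y) (s : Y * W' -> X)
    (pi : probability X R) (k : R.-pker X ~> Y) (k' : R.-pker Y ~> X) :
  measurable_fun setT th -> measurable_fun setT r -> measurable_fun setT s ->
  (forall S, measurable S -> pi S = P (th @^-1` S)) ->
  (forall x T, measurable T -> k x T = Q ((fun w => r (x, w)) @^-1` T)) ->
  (forall y S, measurable S -> k' y S = Q' ((fun w => s (y, w)) @^-1` S)) ->
  (forall S T, measurable S -> measurable T ->
    (P \x Q)%E [set z | S (th z.1) /\ T (r (th z.1, z.2))] =
    ((P \x Q) \x Q')%E [set z | T (r (th z.1.1, z.1.2)) /\
                           S (s (r (th z.1.1, z.1.2), z.2))]) ->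
  bayesian_inversion pi k k'.
Proof.
move=> mth mr ms piE kE k'E PQ S T mS mT.
rewrite (integral_law mth mr piE kE)// PQ//.
pose th' (z : Z * W) := r (th z.1, z.2).
have mth' : measurable_fun setT th'.
  apply: measurableT_comp mr _; apply: measurable_fun_pair => //.
  exact: (measurableT_comp mth measurable_fst).
apply/esym; apply: (@integral_law _ _ _ _ _ _ _ _ (P \x Q)%E Q' th' s) => //.
move=> U mU; rewrite marginalE (integral_law mth mr piE kE)//.
by congr ((P \x Q)%E _); apply/seteqP; split=> z //= [].
Qed.

End laws.

(** * Normal equations *)

Section gram_factorization.
Context (R : realType).

(** [1 + u u^T] has the symmetric square root [1 + t u u^T], with
    [2 t + t^2 |u|^2 = 1]. *)
Lemma add1_rank1_square p (u : 'cV[R]_p) : exists M : 'M[R]_p,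
  M \in unitmx /\ 1%:M + u *m u^T = M *m M^T.
Proof.
pose q := (u^T *m u) 0 0; pose s := Num.sqrt (1 + q); pose t := (1 + s)^-1.
have q0 : 0 <= q.
  by rewrite /q mxE; apply: sumr_ge0 => i _; rewrite mxE -expr2 sqr_ge0.
have uu : u *m u^T *m (u *m u^T) = q *: (u *m u^T).
  by rewrite mulmxA -(mulmxA u) (mx11_scalar (u^T *m u)) mul_mx_scalar -scalemxAl.
have s2 : s ^+ 2 = 1 + q by rewrite sqr_sqrtr// addr_ge0.
have s1 : 1 + s != 0 by rewrite gt_eqF// ltr_wpDr ?sqrtr_ge0.
pose M := 1%:M + t *: (u *m u^T).
have MT : M^T = M by rewrite /M linearD/= linearZ/= trmx1 trmx_mul trmxK.
have MM : 1%:M + u *m u^T = M *m M.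
  rewrite /M mulmxDl mul1mx mulmxDr mulmx1 -scalemxAl -scalemxAr uu !scalerA.
  rewrite -addrA -!scalerDl; congr (_ + _); rewrite -[LHS]scale1r; congr (_ *: _).
  have -> : q = s ^+ 2 - 1 by rewrite s2 addrC addKr.
  by rewrite /t; field.
exists M; split; last by rewrite MT.
have q1 : 1 + q != 0 by rewrite gt_eqF// ltr_wpDr.
(* The inverse of [1 + u u^T] is [1 - u u^T / (1 + q)]. *)
apply: (proj1 (@mulmx1_unit _ _ M (M *m (1%:M - (1 + q)^-1 *: (u *m u^T))) _)).
rewrite mulmxA -MM mulmxBr mulmx1 -scalemxAr mulmxDl mul1mx uu.
rewrite -addrA -[RHS]addr0; congr (_ + _).
rewrite -[X in _ *: (X + _)]scale1r -scalerDl scalerA mulVf// scale1r.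
by rewrite subrr.
Qed.

(** A square root of the penalized Gram matrix, obtained by adding the rows of [X]
    one at a time: if [C C^T] is the matrix before the row [x] is added, the
    matrix after it is [C (1 + u u^T) C^T] with [u = C^-1 x^T]. *)
Lemma ridge_gram_factor n p (X : 'M[R]_(n, p)) (lambda : R) : 0 < lambda ->
  exists C : 'M[R]_p, C \in unitmx /\ X^T *m X + lambda%:M = C *m C^T.
Proof.
move=> l0; elim: n X => [X|n ih]; last rewrite -[n.+1]/(1 + n)%N => X.
- exists (Num.sqrt lambda)%:M; split.
    by rewrite unitmxE det_scalar unitfE expf_neq0// sqrtr_eq0 -ltNge.
  rewrite tr_scalar_mx -scalar_mxM -expr2 sqr_sqrtr ?ltW//.
  by rewrite [X]flatmx0 mulmx0 add0r.
rewrite -[X]vsubmxK.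
set x := usubmx _; set X' := dsubmx _.
have [C [Cu XC]] := ih X'.
have [M [Mu uM]] := add1_rank1_square (invmx C *m x^T).
exists (C *m M); split; first by rewrite unitmx_mul Cu.
rewrite tr_col_mx mul_row_col -addrA XC trmx_mul mulmxA -(mulmxA C) -uM.
rewrite mulmxDr mulmx1 mulmxDl addrC; congr (_ + _).
rewrite trmx_mul trmxK !mulmxA mulmxV// mul1mx -!mulmxA.
by rewrite trmx_inv mulmxA mulVmx ?unitmx_tr// mulmx1.
Qed.

End gram_factorization.

Section ridge_algebra.
Context (R : realType) (n p : nat) (X : 'M[R]_(n, p)).
Variables (s t : R).
Hypotheses (s0 : 0 < s) (t0 : 0 < t).

Let lambda := s ^+ 2 / t ^+ 2.
Let U := X^T *m X + lambda%:M.

Definition ridge_mx : 'M[R]_(p, n) := invmx U *m X^T.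

(** Draws the parameter [t z] and the response [t X z + s w] from the independent
    standard vectors [z] and [w]. *)
Definition joint_mx : 'M[R]_(p + n, p + n) :=
  block_mx t%:M 0 (t *: X) s%:M.

(** Draws the response [y = t X z + s w] as before, and then the parameter
    [M y + L w'] from it, where [M] is the ridge matrix and [w'] is an independent
    standard vector. *)
Definition posterior_joint_mx (L : 'M[R]_p) : 'M[R]_(p + n, p + n + p) :=
  row_mx (block_mx (t *: (ridge_mx *m X)) (s *: ridge_mx) (t *: X) s%:M)
         (col_mx L 0).

Lemma joint_mx_unit : joint_mx \in unitmx.
Proof.
rewrite unitmxE det_lblock !det_scalar unitfE.
by rewrite mulf_neq0// expf_neq0// gt_eqF.
Qed.

(** The factor [L] is a square root of [s^2 U^-1], where [U = X^T X + lambda].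
    The identity [X^T (X X^T + lambda) = U X^T] gives the covariance between
    parameter and response, and the remaining block is then
    [t^2 X^T X U^-1 + s^2 U^-1 = t^2]. *)
Lemma posterior_covariance : exists L : 'M[R]_p,
  joint_mx *m joint_mx^T = posterior_joint_mx L *m (posterior_joint_mx L)^T.
Proof.
have l0 : 0 < lambda by rewrite divr_gt0// exprn_gt0.
have [C [Cu UC]] := ridge_gram_factor X l0.
have Uu : U \in unitmx by rewrite /U UC unitmx_mul Cu unitmx_tr.
have UT : U^T = U by rewrite /U linearD/= trmx_mul trmxK tr_scalar_mx.
have MT : ridge_mx^T = X *m invmx U by rewrite trmx_mul trmxK trmx_inv UT.
pose L := s *: (invmx C)^T; exists L.
have LL : L *m L^T = s ^+ 2 *: invmx U.
  rewrite /L linearZ/= -scalemxAl -scalemxAr scalerA -expr2 trmxK; congr (_ *: _).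
  apply: (can_inj (mulKmx Uu)); rewrite mulmxV// /U UC !mulmxA -(mulmxA C).
  by rewrite -trmx_mul mulVmx// trmx1 mulmx1 mulmxV.
clearbody L.
have MK : t ^+ 2 *: (ridge_mx *m (X *m X^T)) + s ^+ 2 *: ridge_mx = t ^+ 2 *: X^T.
  have -> : s ^+ 2 = t ^+ 2 * lambda.
    by rewrite /lambda mulrC divfK// expf_neq0// gt_eqF.
  rewrite -scalerA -scalerDr; congr (_ *: _).
  apply: (can_inj (mulKmx Uu)); rewrite mulmxDr -scalemxAr /ridge_mx -!mulmxA.
  by rewrite !(mulKVmx Uu) /U mulmxDl mul_scalar_mx !mulmxA.
have MKX : t ^+ 2 *: (ridge_mx *m (X *m X^T) *m ridge_mx^T)
    + s ^+ 2 *: (ridge_mx *m ridge_mx^T) + L *m L^T = (t ^+ 2)%:M.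
  rewrite (scalemxAl (t ^+ 2)) (scalemxAl (s ^+ 2)) -mulmxDl MK LL MT -scalemxAl mulmxA.
  have -> : s ^+ 2 = t ^+ 2 * lambda.
    by rewrite /lambda mulrC divfK// expf_neq0// gt_eqF.
  rewrite -scalerA -scalerDr -[lambda *: _]mul_scalar_mx -mulmxDl mulmxV//.
  by rewrite scalemx1.
rewrite /joint_mx /posterior_joint_mx tr_row_mx mul_row_col tr_col_mx mul_col_row.
rewrite !tr_block_mx !trmx0 !mul0mx !mulmx0 !mulmx_block.
rewrite add_block_mx !mul0mx !mulmx0 !addr0 !tr_scalar_mx.
rewrite !linearZ/= -?scalemxAl -?scalemxAr.
congr block_mx.
- by rewrite -scalar_mxM -expr2 -MKX !scalerA -!expr2 (trmx_mul ridge_mx X) !mulmxA.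
- by rewrite mul_scalar_mx mul_mx_scalar !scalerA -!expr2 -MK !mulmxA.
- rewrite mul_scalar_mx mul_mx_scalar !scalerA -!expr2.
  have := congr1 trmx MK; rewrite linearD/= !linearZ/= (trmx_mul ridge_mx) (trmx_mul X) trmxK => <-.
  by rewrite (trmx_mul ridge_mx X) !mulmxA.
Qed.

End ridge_algebra.

(** * The ridge posterior *)

Section response.
Context (R : realType) (d : design R).
Notation V := (subspace_el (covariate_space d)).
Notation u := (unit_set d).

Definition response (z : (dual_space V * Rpos R) * Rpow R 'I_#|u|) : Rpow R u :=
  [ffun i => (z.1.1 : 'Hom(V, R^o)) (regressor i) +
     Num.sqrt (val (z.1.2 : {s : R | 0 < s})) * (z.2 : {ffun _ -> R}) (enum_rank i)].

Lemma measurable_response : measurable_fun setT response.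
Proof.
apply: measurable_evalP => i; rewrite (_ : (fun _ => _) = fun z =>
  (z.1.1 : 'Hom(V, R^o)) (regressor i) +
     Num.sqrt (val (z.1.2 : {s : R | 0 < s})) * (z.2 : {ffun _ -> R}) (enum_rank i)).
  apply: measurable_funD.
    exact: (measurableT_comp (measurable_dual _)
      (measurableT_comp measurable_fst measurable_fst)).
  apply: measurable_funM.
    have msqrt : measurable_fun [set: R] (@Num.sqrt R).
      by apply: continuous_measurable_fun; exact: sqrt_continuous.
    exact: (measurableT_comp msqrt (measurableT_comp (@measurable_Rpos R)
      (measurableT_comp measurable_snd measurable_fst))).
  exact: (measurableT_comp (measurable_sample _) measurable_snd).
by apply/funext => z; rewrite ffunE.
Qed.

(** The response is the mean plus the standard deviation times a standard
    Gaussian vector, indexed by an enumeration of the units. *)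
Lemma gaussian_modelE (t : dual_space V * Rpos R) (T : set (Rpow R u)) :
  measurable T ->
  gaussian_model d t T = gauss R #|u| ((fun w => response (t, w)) @^-1` T).
Proof.
have mrt : measurable_fun setT (fun w => response (t, w)).
  by apply: measurableT_comp measurable_response _; exact: measurable_fun_pair.
pose rt : {mfun Rpow R 'I_#|u| >-> Rpow R u} :=
  HB.pack (fun w => response (t, w)) (isMeasurableFun.Build _ _ _ _ _ mrt).
move: T; apply: (@eq_probability_box R _ (response_law (d := d) t)
  (distribution (gauss R #|u|) rt)) => B mB.
pose m i := (t.1 : 'Hom(V, R^o)) (regressor i) : R.
pose s := Num.sqrt (val (t.2 : {s : R | 0 < s})).
have s0 : 0 < s by rewrite sqrtr_gt0 (valP (t.2 : {s : R | 0 < s})).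
rewrite [LHS]product_measureE//.
have mB' (j : 'I_#|u|) : measurable ((fun x => m (enum_val j) + s * x) @^-1` B (enum_val j)).
  by rewrite -[X in measurable X]setTI; exact: (@measurable_affine_line R _ s _ _ (mB _)).
transitivity (gauss R #|u| (box (fun j : 'I_#|u| =>
    (fun x => m (enum_val j) + s * x) @^-1` B (enum_val j)))).
  rewrite gauss_box// [LHS](reindex (@enum_val u predT))/=; last first.
    by apply: onW_bij; exact: enum_val_bij.
  by apply: eq_bigr => j _; exact: normal_prob_affine.
rewrite /distribution /pushforward/=; congr (gauss R _ _).
apply/seteqP; split=> w Bw i /=.
  by rewrite ffunE; have := Bw (enum_rank i); rewrite /= enum_rankK.
by have := Bw (enum_val i); rewrite ffunE/= enum_valK.
Qed.

End response.

Section ridge_posterior.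
Context (R : realType) (d : design R).
Variables (sigma2 tau2 : R) (sigma2_gt0 : 0 < sigma2) (tau2_gt0 : 0 < tau2).
Variable ip : inner_products R.
Notation V := (subspace_el (covariate_space d)).
Notation u := (unit_set d).
Notation p := (\dim {: V}).

Let w := covariate_space d.
Let pi := ridge_prior ip tau2 sigma2_gt0.
Let e0 := orthonormal_choice (ip w).
Let X := design_matrix e0.
Let s := Num.sqrt sigma2.
Let t := Num.sqrt tau2.
Let v0 := known_variance sigma2_gt0.

Definition sample_col (y : Rpow R u) : 'cV[R]_#|u| :=
  \col_i (y : {ffun u -> R}) (enum_val i).

Definition posterior_draw (L : 'M[R]_p) (z : Rpow R u * Rpow R 'I_p) :
    dual_space V * Rpos R :=
  (dual_of_col e0 (ridge_estimator e0 (sigma2 / tau2) z.1 + L *m to_col z.2), v0).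

Lemma ridge_estimatorE y :
  ridge_estimator e0 (sigma2 / tau2) y = ridge_mx X s t *m sample_col y.
Proof. by rewrite /ridge_mx !sqr_sqrtr ?ltW. Qed.

Lemma measurable_sample_col i :
  measurable_fun setT (fun y : Rpow R u => sample_col y i 0).
Proof.
rewrite (_ : (fun _ => _) = fun y : Rpow R u => (y : {ffun _ -> R}) (enum_val i)).
  exact: measurable_sample.
by apply/funext => y; rewrite mxE.
Qed.

Lemma measurable_posterior_draw L : measurable_fun setT (posterior_draw L).
Proof.
apply: measurable_fun_pair => //; apply: measurable_dual_of_col => i.
rewrite (_ : (fun _ => _) = fun z : Rpow R u * Rpow R 'I_p =>
  (ridge_mx X s t *m sample_col z.1) i 0 + (L *m to_col z.2) i 0).
  apply: measurable_funD.
    apply: (@measurable_mulmx _ _ _ _ _ _ (fun z => sample_col z.1)) => j.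
    exact: (measurableT_comp (measurable_sample_col j) measurable_fst).
  apply: (@measurable_mulmx _ _ _ _ _ _ (fun z => to_col z.2)) => j.
  exact: (measurableT_comp (measurable_to_col j) measurable_snd).
by apply/funext => z; rewrite mxE ridge_estimatorE.
Qed.

Definition posterior_law (L : 'M[R]_p) (y : Rpow R u) :
    probability (dual_space V * Rpos R)%type R :=
  (dual_normal e0 (ridge_estimator e0 (sigma2 / tau2) y) L \x \d_v0)%E.

Lemma posterior_lawE L y (S : set (dual_space V * Rpos R)) : measurable S ->
  posterior_law L y S =
  gauss R p ((fun z => posterior_draw L (y, z)) @^-1` S).
Proof. exact: dual_normal_diracE. Qed.

Lemma measurable_posterior_law L S : measurable S ->
  measurable_fun setT (fun y => posterior_law L y S).
Proof.
move=> mS; rewrite (_ : (fun _ => _) = fun y =>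
    gauss R p ((fun z => posterior_draw L (y, z)) @^-1` S)).
  by apply: measurable_law => //; exact: measurable_posterior_draw.
by apply/funext => y; rewrite posterior_lawE.
Qed.

Definition posterior_kernel L : R.-pker (Rpow R u) ~> (dual_space V * Rpos R)%type :=
  family_kernel (measurable_posterior_law L).

Definition prior_draw (z : Rpow R 'I_p) : dual_space V * Rpos R :=
  (dual_of_col e0 (t *: to_col z), v0).

Lemma measurable_prior_draw : measurable_fun setT prior_draw.
Proof.
apply: measurable_fun_pair => //; apply: measurable_dual_of_col => i.
rewrite (_ : (fun _ => _) = fun z => t * to_col z i 0).
  by apply: measurable_funM => //; exact: measurable_to_col.
by apply/funext => z; rewrite mxE.
Qed.

(** The known variance is put back and the units are restored as indices, so that
    both joint laws are images of Gaussian laws on coordinates by one map. *)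
Definition joint_of_coords (c : Rpow R 'I_(p + #|u|)) :
    (dual_space V * Rpos R) * Rpow R u :=
  ((dual_of_col e0 (usubmx (to_col c)), v0),
   [ffun i => dsubmx (to_col c) (enum_rank i) 0]).

Lemma measurable_joint_of_coords : measurable_fun setT joint_of_coords.
Proof.
have mc i : measurable_fun setT (fun c : Rpow R 'I_(p + #|u|) => to_col c i 0).
  exact: measurable_to_col.
apply: measurable_fun_pair.
  apply: measurable_fun_pair => //; apply: measurable_dual_of_col => i.
  rewrite (_ : (fun _ => _) = fun c : Rpow R 'I_(p + #|u|) => to_col c (lshift _ i) 0)//.
  by apply/funext => c; rewrite mxE.
apply: measurable_evalP => i.
rewrite (_ : (fun _ => _) =
  fun c : Rpow R 'I_(p + #|u|) => to_col c (rshift _ (enum_rank i)) 0)//.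
by apply/funext => c; rewrite ffunE mxE.
Qed.

Lemma response_coordsE (c : 'cV[R]_p) (z : Rpow R 'I_#|u|) :
  response ((dual_of_col e0 c, v0), z) =
  [ffun i => (X *m c + s *: to_col z) (enum_rank i) 0].
Proof.
apply/ffunP => i; rewrite !ffunE dual_of_colE !mxE; congr (_ + _).
by apply: eq_bigr => j _; rewrite mxE enum_rankK mulrC.
Qed.

Lemma joint_drawE (z : Rpow R 'I_p * Rpow R 'I_#|u|) :
  (prior_draw z.1, response (prior_draw z.1, z.2)) =
  joint_of_coords (lin (joint_mx X s t) (concat z)).
Proof.
rewrite /joint_of_coords /lin !of_colK /joint_mx mul_block_col col_mxKu col_mxKd.
rewrite mul0mx addr0 !mul_scalar_mx -scalemxAl scalemxAr.
by rewrite -response_coordsE.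
Qed.

Lemma posterior_drawE L (z : (Rpow R 'I_p * Rpow R 'I_#|u|) * Rpow R 'I_p) :
  let y := response (prior_draw z.1.1, z.1.2) in
  (posterior_draw L (y, z.2), y) =
  joint_of_coords (lin (posterior_joint_mx X s t L) (concat (concat z.1, z.2))).
Proof.
move=> y; have yE : sample_col y = X *m (t *: to_col z.1.1) + s *: to_col z.1.2.
  apply/colP => i; rewrite mxE /y response_coordsE ffunE enum_valK.
  by rewrite !mxE.
rewrite /joint_of_coords /lin !of_colK /posterior_joint_mx mul_row_col.
rewrite mul_block_col mul_col_mx add_col_mx col_mxKu col_mxKd mul0mx addr0.
rewrite !mul_scalar_mx -!scalemxAl; congr (_, _).
  rewrite /posterior_draw ridge_estimatorE yE; congr (dual_of_col _ (_ + _), _).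
  by rewrite mulmxDr -!scalemxAr !mulmxA.
by rewrite /y response_coordsE -scalemxAr.
Qed.

Lemma posterior_kernel_inversion : exists L,
  bayesian_inversion (pi w) (gaussian_model d) (posterior_kernel L).
Proof.
have s0 : 0 < s by rewrite sqrtr_gt0.
have t0 : 0 < t by rewrite sqrtr_gt0.
have [L cov] := posterior_covariance X s0 t0.
exists L.
apply: (bayesian_inversion_of_joint measurable_prior_draw (@measurable_response R d)
  (measurable_posterior_draw L) (P := gauss R p) (Q := gauss R #|u|) (Q' := gauss R p)).
- by move=> S mS; exact: ridge_priorE.
- exact: gaussian_modelE.
- exact: posterior_lawE.
move=> S T mS mT.
pose C := joint_of_coords @^-1` (S `*` T).
have mC : measurable C.
  rewrite -[X in measurable X]setTI; apply: measurable_joint_of_coords => //.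
  exact: measurableX.
have := gauss_cov_eq cov _ mC; rewrite unitmx_mul unitmx_tr joint_mx_unit// => /(_ isT).
rewrite gauss_concat; last exact: preimage_lin_measurable.
rewrite gauss_concat3; last exact: preimage_lin_measurable.
move=> E; apply: (etrans _ (etrans E _)); congr product_measure1.
- have CE z : (S `*` T) (prior_draw z.1, response (prior_draw z.1, z.2)) =
      C (lin (joint_mx X s t) (concat z)) by rewrite joint_drawE.
  by apply/seteqP; split=> z; rewrite /preimage/= -CE.
- have CE z : let y := response (prior_draw z.1.1, z.1.2) in
      (S `*` T) (posterior_draw L (y, z.2), y) =
      C (lin (posterior_joint_mx X s t L) (concat (concat z.1, z.2))).
    by move=> y; rewrite posterior_drawE.
  apply/seteqP; split=> z; first by rewrite /preimage/= -CE => -[].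
  by move=> [Tz Sz]; rewrite /preimage/= -CE.
Qed.

(** A change of orthonormal basis multiplies the design matrix by an orthogonal
    matrix, and the ridge estimator commutes with it because the penalty is
    a scalar matrix. *)
Lemma posterior_law_basis L e : orthonormal_basis (ip w) e ->
  exists L' : 'M[R]_p, forall y : sample_space R u,
    posterior_kernel L y ≡μ
    (dual_normal e (ridge_estimator e (sigma2 / tau2) y) L' \x \d_v0)%E.
Proof.
move=> eo; have e0o := orthonormal_choiceP ip w.
pose Q := coord_mx e e0 \1%VF.
have QQ : Q *m Q^T = 1%:M.
  by apply: (coord_mx_isometry eo e0o) => x y; rewrite !id_lfunE.
have QQ' := mulmx1C QQ.
exists (Q *m L) => y S mS.
rewrite [LHS]posterior_lawE// [RHS]dual_normal_diracE//; congr (gauss R _ _).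
have XE : design_matrix e = X *m Q^T.
  apply/matrixP => i j; rewrite !mxE (coord_ip _ _ eo) (ip_coord _ _ e0o).
  by apply: eq_bigr => k _; rewrite !mxE id_lfunE.
have mE : ridge_estimator e (sigma2 / tau2) y = Q *m ridge_estimator e0 (sigma2 / tau2) y.
  have l0 : 0 < sigma2 / tau2 by rewrite divr_gt0.
  have [C [Cu UC]] := ridge_gram_factor X l0.
  set U := X^T *m X + (sigma2 / tau2)%:M in UC.
  have Uu : U \in unitmx by rewrite UC unitmx_mul Cu unitmx_tr.
  have Qu : Q \in unitmx by have [] := mulmx1_unit QQ.
  have UE : (design_matrix e)^T *m design_matrix e + (sigma2 / tau2)%:M = Q *m U *m Q^T.
    rewrite XE trmx_mul trmxK /U mulmxDr mulmxDl mul_mx_scalar -scalemxAl QQ scalemx1.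
    by rewrite !mulmxA.
  rewrite /ridge_estimator -/X UE XE trmx_mul trmxK -/U !mulmxA.
  congr (_ *m _); congr (_ *m _).
  have QUu : Q *m U *m Q^T \in unitmx by rewrite !unitmx_mul Qu Uu unitmx_tr.
  apply: (can_inj (mulKmx QUu)); rewrite mulKVmx// -!mulmxA (mulmxA Q^T) QQ' mul1mx.
  by rewrite mulmxV// mulmx1.
apply/seteqP.
have E z : dual_of_col e0 (ridge_estimator e0 (sigma2 / tau2) y + L *m to_col z) =
    dual_of_col e (ridge_estimator e (sigma2 / tau2) y + Q *m L *m to_col z).
  rewrite mE -mulmxA -mulmxDr -(dual_of_col_comp e0 eo).
  by apply/lfunP => x; rewrite comp_lfunE id_lfunE.
by split=> z /=; rewrite /posterior_draw/= E.
Qed.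

End ridge_posterior.

Theorem theorem1p7 (R : realType) :
  (forall (Om : covariate_category) (Theta : parameter_functor R Om)
      (pi : prior Theta),
    (forall (w w' : Om) (psi : cov_hom w w'), coherent_at pi psi ->
      forall A : set (Theta w), measurable A ->
        A `&` range (par_map Theta psi) = set0 -> pi w A = 0%E)
    /\
    (coherent_over pi (@Omega_inj Om) -> Aut_invariant pi))
  /\
  (exists (Om : covariate_category) (Theta : parameter_functor R Om)
      (pi : prior Theta),
    coherent_over pi (@Omega_red Om) /\ ~ Aut_invariant pi)
  /\
  (forall (sigma2 tau2 : R) (sigma2_gt0 : 0 < sigma2) (tau2_gt0 : 0 < tau2)
      (ip : inner_products R), restricts_along_insertions ip ->
    let pi := ridge_prior ip tau2 sigma2_gt0 in
    (forall d : design R,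
      exists k : R.-pker (sample_space R (unit_set d))
                   ~> (gaussian_parameters R (covariate_space d)),
        bayesian_inversion (pi (covariate_space d)) (gaussian_model d) k /\
        forall e, orthonormal_basis (ip (covariate_space d)) e ->
          exists L : 'M[R]_(\dim {: subspace_el (covariate_space d)}),
          forall y : sample_space R (unit_set d),
            k y ≡μ (dual_normal e (ridge_estimator e (sigma2 / tau2) y) L
                     \x \d_(known_variance sigma2_gt0))%E)
    /\
    coherent_over pi (@Omega_red (subspace_category R))
    /\
    (forall (w : subspace_category R) (A : cov_hom w w), iso A ->
      (coherent_at pi A <-> isometry (ip w) (ip w) (cov_fun A)))
    /\
    ~ coherent_over pi (@Omega_inj (subspace_category R))).
Proof.
split; last split.
- move=> Om Theta pi; split; last exact: coherent_over_inj_invariant.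
  by move=> w w' psi cpsi A; exact: coherent_at_null.
- exists bool_category, (bool_functor R), (dirac_prior R); split.
    exact: dirac_prior_coherent.
  exact: dirac_prior_not_invariant.
move=> sigma2 tau2 sigma2_gt0 tau2_gt0 ip res pi; split; last split; last split.
- move=> d.
  have [L inv] := posterior_kernel_inversion d sigma2_gt0 tau2_gt0 ip.
  exists (posterior_kernel sigma2_gt0 tau2_gt0 ip L); split=> // e eo.
  exact: posterior_law_basis.
- exact: ridge_prior_coherent_over_red.
- move=> w A _; split; first exact: ridge_prior_coherent_isometry.
  exact: ridge_prior_isometry.
- exact: ridge_prior_not_coherent_over_inj.
Qed.
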